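(* Let $n\ge2$ and let $$N(t_0,\ldots,t_{n-1})=\mathrm{CT}\left(\prod_{1\le i<j\le n}\frac{(x_j-x_i)(1+t_ix_j)}{1-x_ix_j}\prod_{i=1}^n\frac{1+t_0x_i}{1-x_i^2}\prod_{i=1}^n x_i^{-2i+2}\right).$$ Then $N(t_0,\ldots,t_{n-1})$ is the commutative image of the sum of all skew semi-standard tableaux of outer shape $\rho=(n-1,\ldots,1)$, with inner shape any partition contained in $\rho$ all of whose columns have even length, satisfying the flag condition $2,3,\ldots,n$. That is, $$N(t_0,\ldots,t_{n-1})=\sum_{\mu}\ \sum_{T}\ \prod_{b}t_{T(b)-1},$$ where $\mu$ runs over the partitions $\mu\subseteq\rho$ with all columns of even length, $T$ over the semi-standard tableaux of shape $\rho/\mu$ satisfying the flag condition, and $b$ over the boxes of $\rho/\mu$.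
   Context: $\mathrm{CT}$ denotes the constant term with respect to all variables $x_1,\ldots,x_n$, with all factors $(1-x_ix_j)^{-1}$ and $(1-x_i^2)^{-1}$ expanded as power series in the $x$'s; $t_0,\ldots,t_{n-1}$ are indeterminates. Tableaux are drawn in the French way (Cartesian plane): the first (longest) row is at the bottom, so the $i$-th row from the bottom of $\rho$ has $n-i$ boxes. A semi-standard tableau of skew shape $\rho/\mu$ is a filling of the boxes of $\rho/\mu$ by positive integers that is weakly increasing from left to right along rows and strictly increasing from bottom to top along columns. The flag condition $2,3,\ldots,n$ means that the entries in the bottom row belong to $\{1,2\}$, those in the next row to $\{1,2,3\}$, ..., those in the top row to $\{1,\ldots,n\}$ (the $i$-th row from the bottom has entries in $\{1,\ldots,i+1\}$). The entry $k$ stands for the letter $t_{k-1}$ of the alphabet $(t_0,t_1,t_2,\ldots)$; the commutative image of a tableau is the product of its letters. *)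

(* Defs.v *)
(* boolp provides the classical eqType and choiceType structures that the ring
   structure on power series requires. *)
From HB Require Import structures.
From mathcomp Require Import all_boot all_order all_algebra.
From mathcomp Require Import boolp.
From mathcomp Require Import mpoly.

Set Implicit Arguments.
Unset Strict Implicit.
Unset Printing Implicit Defensive.

Import GRing.Theory.
Local Open Scope ring_scope.

(* Formal power series in n variables, given by their coefficients. *)
Definition mfps (n : nat) (R : comNzRingType) : Type := 'X_{1..n} -> R.

HB.instance Definition _ n R := gen_eqMixin (mfps n R).
HB.instance Definition _ n R := gen_choiceMixin (mfps n R).

Section PowerSeries.
Context (n : nat) (R : comNzRingType).
Implicit Types (f g h u : mfps n R) (c : R) (m : 'X_{1..n}) (p q : {mpoly R[n]}).

Definition fpsC c : mfps n R := fun m => if m == 0%MM then c else 0.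
Definition fpsX (i : 'I_n) : mfps n R := fun m => (m == U_(i)%MM)%:R.
Definition fps_opp f : mfps n R := fun m => - f m.
Definition fps_add f g : mfps n R := fun m => f m + g m.

(* Same indexing of the convolution as in mcoeffM. *)
Definition fps_mul f g : mfps n R := fun m =>
  \sum_(k : 'X_{1..n < (mdeg m).+1, (mdeg m).+1} | m == (k.1 + k.2)%MM)
     f k.1 * g k.2.

Lemma fps_addA : associative fps_add.
Proof. by move=> f g h; apply: funext => m; rewrite /fps_add addrA. Qed.

Lemma fps_addC : commutative fps_add.
Proof. by move=> f g; apply: funext => m; rewrite /fps_add addrC. Qed.

Lemma fps_add0 : left_id (fpsC 0) fps_add.
Proof.
by move=> f; apply: funext => m; rewrite /fps_add /fpsC if_same add0r.
Qed.

Lemma fps_addN : left_inverse (fpsC 0) fps_opp fps_add.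
Proof.
by move=> f; apply: funext => m; rewrite /fps_add /fps_opp /fpsC if_same addNr.
Qed.

HB.instance Definition _ := GRing.isZmodule.Build (mfps n R)
  fps_addA fps_addC fps_add0 fps_addN.

Definition fps_agree (d : nat) f p := forall m, (mdeg m < d)%N -> f m = p@_m.

Definition fps_trunc (d : nat) f : {mpoly R[n]} :=
  \sum_(m : 'X_{1..n < d}) f m *: 'X_[m].

Lemma fps_agree_trunc d f : fps_agree d f (fps_trunc d f).
Proof. by move=> m lt_md; rewrite /fps_trunc (mcoeff_mpoly f). Qed.

Lemma fps_agreeC d c : fps_agree d (fpsC c) c%:MP.
Proof.
by move=> m _; rewrite mcoeffC /fpsC; case: eqP; rewrite ?mulr1 ?mulr0.
Qed.

Lemma fps_agreeD d f g p q :
  fps_agree d f p -> fps_agree d g q -> fps_agree d (fps_add f g) (p + q).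
Proof. by move=> fp gq m lt_md; rewrite mcoeffD /fps_add fp ?gq. Qed.

Lemma fps_agreeM d f g p q :
  fps_agree d f p -> fps_agree d g q -> fps_agree d (fps_mul f g) (p * q).
Proof.
move=> fp gq m lt_md; rewrite mcoeffM; apply: eq_bigr => k _.
by rewrite fp ?gq //; apply: leq_trans (bmdeg _) lt_md.
Qed.

Lemma fps_agree_eq f g :
  (forall d, exists2 p, fps_agree d f p & fps_agree d g p) -> f = g.
Proof.
move=> fg; apply: funext => m.
by have [p fp gp] := fg (mdeg m).+1; rewrite fp ?gp.
Qed.

Lemma fps_mulA : associative fps_mul.
Proof.
move=> f g h; apply: fps_agree_eq => d.
exists (fps_trunc d f * (fps_trunc d g * fps_trunc d h)); last rewrite mulrA;
  by do ![apply: fps_agreeM | apply: fps_agree_trunc].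
Qed.

Lemma fps_mulC : commutative fps_mul.
Proof.
move=> f g; apply: fps_agree_eq => d.
exists (fps_trunc d f * fps_trunc d g); last rewrite mulrC;
  by do ![apply: fps_agreeM | apply: fps_agree_trunc].
Qed.

Lemma fps_mul1 : left_id (fpsC 1) fps_mul.
Proof.
move=> f; apply: fps_agree_eq => d; exists (1%:MP * fps_trunc d f).
  by apply: fps_agreeM; [apply: fps_agreeC | apply: fps_agree_trunc].
by rewrite mul1r; apply: fps_agree_trunc.
Qed.

Lemma fps_mulDl : left_distributive fps_mul +%R.
Proof.
move=> f g h; apply: fps_agree_eq => d.
exists ((fps_trunc d f + fps_trunc d g) * fps_trunc d h); last rewrite mulrDl;
  by do ![apply: fps_agreeM | apply: fps_agreeD | apply: fps_agree_trunc].
Qed.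

Lemma fps_oner_neq0 : fpsC 1 != 0.
Proof.
apply/eqP => fps10.
have /eqP : fpsC 1 0%MM = fpsC 0 0%MM :> R by congr (_ _); apply: fps10.
by rewrite /fpsC eqxx oner_eq0.
Qed.

HB.instance Definition _ := GRing.Zmodule_isComNzRing.Build (mfps n R)
  fps_mulA fps_mulC fps_mul1 fps_mulDl fps_oner_neq0.

(* The expansion \sum_k u ^+ k of (1 - u)^-1, for u without constant term:
   (u ^+ k) m is then 0 as soon as mdeg m < k. *)
Definition fps_geom u : mfps n R := fun m =>
  \sum_(k < (mdeg m).+1) (u ^+ k : mfps n R) m.

Lemma fps_sumE (I : Type) (r : seq I) (P : pred I) (F : I -> mfps n R) m :
  (\sum_(i <- r | P i) F i) m = \sum_(i <- r | P i) F i m.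
Proof.
elim/big_rec2: _ => [|i y f _ <-] //.
by rewrite /GRing.zero /= /fpsC if_same.
Qed.

Lemma fps_exp_small u k m :
  u 0%MM = 0 -> (mdeg m < k)%N -> (u ^+ k : mfps n R) m = 0.
Proof.
move=> u0; elim: k m => // k IHk m lt_mk; rewrite exprS.
apply: big1 => -[[a lta] [b ltb]] /= /eqP mE.
have [->|nz_a] := eqVneq a 0%MM; first by rewrite u0 mul0r.
rewrite IHk ?mulr0 //; move: lt_mk; rewrite mE mdegD ltnS.
by apply: leq_trans; rewrite -[ltnLHS]add0n ltn_add2r lt0n mdeg_eq0.
Qed.

Lemma fps_geomP u : u 0%MM = 0 -> (1 - u) * fps_geom u = 1.
Proof.
move=> u0; apply: funext => m.
have -> : ((1 - u) * fps_geom u) m =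
          ((1 - u) * \sum_(k < (mdeg m).+1) u ^+ k) m.
  apply: eq_bigr => -[[a lta] [b ltb]] /= _; congr (_ * _).
  rewrite fps_sumE /fps_geom.
  rewrite (big_ord_widen _ (fun k => (u ^+ k : mfps n R) b) ltb) big_mkcond /=.
  by apply: eq_bigr => k _; case: ltnP => // lt_bk; rewrite fps_exp_small.
rewrite -opprB mulNr -subrX1 opprB -[RHS]addr0; congr (_ + _).
by rewrite -oppr0 -(fps_exp_small u0 (ltnSn (mdeg m))).
Qed.

Lemma fps_geomXX (i j : 'I_n) :
  (1 - fpsX i * fpsX j) * fps_geom (fpsX i * fpsX j) = 1.
Proof.
apply: fps_geomP; apply: big1 => -[[a lta] [b ltb]] /=.
move=> /eqP/(congr1 (@mdeg n)); rewrite mdeg0 mdegD => /esym/eqP.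
rewrite addn_eq0 !mdeg_eq0 => /andP[/eqP-> _].
rewrite /fpsX; case: eqP => [/(congr1 (@mdeg n))|_]; last by rewrite mul0r.
by rewrite mdeg0 mdeg1.
Qed.

(* Laurent series in n variables, again given by their coefficients: a power
   series, and its product by the Laurent monomial of exponent vector e. *)
Definition laurent : Type := {ffun 'I_n -> int} -> R.

Definition laurent_of_fps f : laurent := fun d =>
  if [forall i, 0 <= d i] then f [multinom `|d i|%N | i < n] else 0.

Definition laurent_mulX (e : {ffun 'I_n -> int}) (F : laurent) : laurent :=
  fun d => F (d - e).

Definition CT (F : laurent) : R := F 0.

End PowerSeries.

(* The indeterminate t_k for k < n; the default value 0 is never reached below. *)
Definition tvar (n k : nat) : {mpoly int[n]} :=
  oapp (fun i : 'I_n => 'X_i) 0 (insub k).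

(* The ordinal i : 'I_n is the index i + 1 of the variables x_1, ..., x_n;
   the letters t_0, ..., t_(n-1) keep their own numbering. *)
Definition Nct (n : nat) : {mpoly int[n]} :=
  let x i : mfps n {mpoly int[n]} := fpsX _ i in
  let t k : mfps n {mpoly int[n]} := fpsC (tvar n k) in
  CT (laurent_mulX [ffun i : 'I_n => - 2%:Z * i.+1%:Z + 2%:Z]
    (laurent_of_fps
      ((\prod_(i < n) \prod_(j < n | (i < j)%N)
          ((x j - x i) * (1 + t i.+1 * x j) * fps_geom (x i * x j)))
       * \prod_(i < n) ((1 + t 0%N * x i) * fps_geom (x i ^+ 2))))).

(* Rows and columns are numbered from 0, the row 0 being the bottom one. *)
Definition rho (n r : nat) : nat := (n - r.+1)%N.

(* A partition contained in rho is the sequence of its n - 1 first parts,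
   completed by zeros. *)
Definition inner_shape (n : nat) (mu : {ffun 'I_n.-1 -> 'I_n}) : bool :=
  [forall r : 'I_n.-1, forall r' : 'I_n.-1, (r <= r')%N ==> (mu r' <= mu r)%N] &&
  [forall r : 'I_n.-1, mu r <= rho n r]%N.

Definition even_columns (n : nat) (mu : {ffun 'I_n.-1 -> 'I_n}) : bool :=
  [forall c : 'I_n.-1, ~~ odd #|[set r : 'I_n.-1 | (c < mu r)%N]|].

(* Boxes (row, column) of rho / mu. *)
Definition skew_box (n : nat) (mu : {ffun 'I_n.-1 -> 'I_n}) : finType :=
  {b : 'I_n.-1 * 'I_n.-1 | (mu b.1 <= b.2 < rho n b.1)%N}.

Definition box_row (n : nat) (mu : {ffun 'I_n.-1 -> 'I_n}) (b : skew_box mu) :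
  'I_n.-1 := (val b).1.

Definition box_col (n : nat) (mu : {ffun 'I_n.-1 -> 'I_n}) (b : skew_box mu) :
  'I_n.-1 := (val b).2.

(* The flag condition bounds the entries by n, whence fillings in 'I_n.+1. *)
Definition filling (n : nat) (mu : {ffun 'I_n.-1 -> 'I_n}) : finType :=
  {ffun skew_box mu -> 'I_n.+1}.

Definition semistandard (n : nat) (mu : {ffun 'I_n.-1 -> 'I_n})
    (T : filling mu) : bool :=
  [&& [forall b, 0 < T b]%N,
      [forall b, forall b', (box_row b == box_row b') && (box_col b <= box_col b')%N
                              ==> (T b <= T b')%N] &
      [forall b, forall b', (box_col b == box_col b') && (box_row b < box_row b')%N
                              ==> (T b < T b')%N]].

(* The row r is the (r + 1)-th one, whose entries are at most r + 2. *)
Definition flagged (n : nat) (mu : {ffun 'I_n.-1 -> 'I_n})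
    (T : filling mu) : bool :=
  [forall b, T b <= (box_row b).+2]%N.

(* Main.v *)
Require Import Defs.
From mathcomp Require Import all_boot all_order all_algebra.
From mathcomp Require Import boolp.
From mathcomp Require Import perm mpoly.
From mathcomp Require Import zify ring.

(** The variables are written x_0, ..., x_(n-1), and an exponent vector is read
    as the list of the positions of n particles on the half-line of naturals.

    The factors of the constant term that are free of the letters form the
    series Phi = \prod_(i < j) (x_j - x_i) * \prod_(i <= j) (1 - x_i x_j)^-1.
    By Littlewood's identity, Phi is the sum of the alternants of the partitions
    with even rows: its coefficient at a is the sign of the permutation that
    sorts a if the sorted entries are alternately even and odd, starting with an
    even one, and is 0 otherwise ([littlewood]).  This is proved by induction on
    the number of variables.  Call an entry misplaced if its parity is not that
    of its rank, and let the defect count the misplaced entries.  Multiplying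
    the series of defect 0 by the s-th elementary symmetric polynomial gives the
    series of defect s ([defect_series_elem_sym]), because the only particles
    that can have moved by one step from a configuration of defect 0 are the
    misplaced ones.  After expansion of the products of the factors 1 - x_k x_i
    and x_k - x_i, the induction step ([defect_series_step]) becomes an identity
    between coefficients, and this is a telescoping sum over the exponent of x_k
    ([insertion_sum]).

    The letters enter through the factors 1 + t_k x_j for k <= j, and the constant
    term is the coefficient of Phi times these factors at the exponent vector
    (0, 2, 4, ...) ([Nct_letter_series]).  The factors of a given letter t_k move
    a subset of the particles j >= k by one step each.  With the letters before
    t_k only, the series is alternating in the x_j with j >= k - 1, so that moves
    after which two particles coincide contribute nothing ([letter_series_eq0]).
    Let the particle j sit at j + h_j, and use up the letters from the last one
    to t_0.  At first h_j = j, the height of a column of the staircase rho; the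
    surviving moves of t_k remove a horizontal strip from the columns of height at
    least k, and the final shape counts with weight 1 if its columns are even, and
    0 otherwise ([letter_series_arrays]).

    Such a sequence of shapes from rho down to mu is a semistandard tableau of
    shape rho / mu, and the restriction of t_k to the columns of height at least
    k is the flag condition ([array_tableau_sum]).  The heights of a column
    and its entries determine each other by the same operation of counting the
    values below a threshold ([count_le_threshold]). *)

Set Implicit Arguments.
Unset Strict Implicit.
Unset Printing Implicit Defensive.

Import GRing.Theory Num.Theory.
Local Open Scope ring_scope.

(** * Power series: monomials and permutations of the variables *)

Section Series.
Context (n : nat) (R : comNzRingType).
Implicit Types (f g : mfps n R) (m u v : 'X_{1..n}) (s : {perm 'I_n}).
Local Notation x := (@fpsX n R).

Definition fps_monom u : mfps n R := fun m => (m == u)%:R.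

Lemma fps_mulE f g m : (f * g) m =
  \sum_(k : 'X_{1..n < (mdeg m).+1, (mdeg m).+1} | m == (k.1 + k.2)%MM)
     f k.1 * g k.2.
Proof. by []. Qed.

Lemma fps_mul_monomE f u m :
  (f * fps_monom u) m = if (u <= m)%MM then f (m - u)%MM else 0.
Proof.
rewrite fps_mulE; case: ifPn => [le_um|nle_um].
  have lt1 : (mdeg (m - u)%MM < (mdeg m).+1)%N.
    by rewrite ltnS; move: (congr1 (@mdeg n) (submK le_um)); rewrite mdegD; lia.
  have lt2 : (mdeg u < (mdeg m).+1)%N.
    by rewrite ltnS; move: (congr1 (@mdeg n) (submK le_um)); rewrite mdegD; lia.
  rewrite (bigD1 (BMultinom lt1, BMultinom lt2)) /=; last by rewrite submK.
  rewrite /fps_monom eqxx mulr1 big1 ?addr0 // => -[[a lta] [b ltb]] /=.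
  case/andP=> /eqP mE neq; case: (b =P u) => [bE|]; last by rewrite mulr0.
  case/negP: neq; apply/eqP; congr pair; apply: val_inj => //=.
  by rewrite mE bE addmK.
apply: big1 => -[[a lta] [b ltb]] /= /eqP mE.
rewrite /fps_monom; case: eqP => [bE|]; last by rewrite mulr0.
by case/negP: nle_um; rewrite mE bE lem_addl.
Qed.

Lemma fps_monomD u v : fps_monom (u + v)%MM = fps_monom u * fps_monom v.
Proof.
apply: funext => m; rewrite fps_mul_monomE /fps_monom; case: ifPn => [le_vm|nle].
  by congr ((_ : bool)%:R); apply/eqP/eqP => [->|<-]; rewrite ?addmK ?submK.
by case: eqP nle => // ->; rewrite lem_addl.
Qed.

Lemma fps_monom0 : fps_monom 0%MM = 1.
Proof. by apply: funext => m; rewrite /fps_monom /GRing.one /= /fpsC; case: eqP. Qed.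

Lemma fps_monom_sum (I : Type) (r : seq I) (P : pred I) (F : I -> 'X_{1..n}) :
  fps_monom (\sum_(i <- r | P i) F i)%MM = \prod_(i <- r | P i) fps_monom (F i).
Proof.
elim/big_rec2: _ => [|i y u _ <-]; [exact: fps_monom0|exact: fps_monomD].
Qed.

Lemma fpsCM (c : R) f m : (fpsC c * f) m = c * f m.
Proof.
rewrite -[in RHS](mul1r f) !fps_mulE big_distrr /=; apply: eq_bigr => k _.
rewrite [in RHS]/GRing.one /= /fpsC; case: eqP; first by rewrite mul1r.
by rewrite !mul0r mulr0.
Qed.

Lemma fpsC_exp (c : R) k : fpsC c ^+ k = fpsC (c ^+ k) :> mfps n R.
Proof.
elim: k => [|k IHk]; first by rewrite !expr0.
rewrite !exprS IHk; apply: funext => m; rewrite fpsCM /fpsC.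
by case: eqP => // _; rewrite mulr0.
Qed.

Definition fps_perm s f : mfps n R := fun m => f [multinom m (s i) | i < n].

Lemma fps_agree_perm d f p s :
  fps_agree d f p -> fps_agree d (fps_perm s f) (msym s p).
Proof. by move=> fp m lt_md; rewrite mcoeff_sym -fp // mdeg_mperm. Qed.

(** On polynomials that agree with f and g up to some degree, the action is the
    ring morphism msym. *)
Lemma fps_permM s f g : fps_perm s (f * g) = fps_perm s f * fps_perm s g.
Proof.
apply: fps_agree_eq => d; exists (msym s (fps_trunc d f * fps_trunc d g)).
  by apply: fps_agree_perm; apply: fps_agreeM; apply: fps_agree_trunc.
by rewrite msymM; apply: fps_agreeM; apply: fps_agree_perm; apply: fps_agree_trunc.
Qed.

Lemma fps_permD s f g : fps_perm s (f + g) = fps_perm s f + fps_perm s g.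
Proof. by []. Qed.

Lemma fps_permC s (c : R) : fps_perm s (fpsC c) = fpsC c.
Proof.
apply: funext => m; rewrite /fps_perm /fpsC; congr (if _ then _ else _).
by rewrite -!mdeg_eq0 mdeg_mperm.
Qed.

Lemma fps_permX s i : fps_perm s (x i) = x (s i).
Proof.
apply: funext => m; rewrite /fps_perm /fpsX; congr ((_ : bool)%:R).
apply/eqP/eqP => [/mnmP mE|->]; apply/mnmP => j.
  by have := mE (s^-1%g j); rewrite mnmE permKV !mnm1E => ->;
     rewrite -(inj_eq (@perm_inj _ s)) permKV.
by rewrite mnmE !mnm1E (inj_eq perm_inj).
Qed.

Lemma fps_perm_sum s (I : Type) (r : seq I) (P : pred I) (F : I -> mfps n R) :
  fps_perm s (\sum_(i <- r | P i) F i) = \sum_(i <- r | P i) fps_perm s (F i).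
Proof. by apply: big_morph => //; apply: fps_permC. Qed.

Lemma fps_perm_prod s (I : Type) (r : seq I) (P : pred I) (F : I -> mfps n R) :
  fps_perm s (\prod_(i <- r | P i) F i) = \prod_(i <- r | P i) fps_perm s (F i).
Proof. by apply: big_morph => [f g|]; [apply: fps_permM|apply: fps_permC]. Qed.

End Series.

(** * Sign and defect of an exponent vector *)

Section Insertion.
Context (k : nat) (a : nat -> nat).

Definition injective_upto := forall i j, (i < k)%N -> (j < k)%N -> a i = a j -> i = j.

(** The sign of the permutation that sorts a, and 0 if a is not injective. *)
Definition vsign : int := \prod_(j < k) \prod_(i < j) sgz ((a j)%:Z - (a i)%:Z).
Definition below (v : nat) : nat := (\sum_(i < k) (a i < v))%N.

(** [below (a i)] is the rank of a i, so that nothing is misplaced exactly when the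
    sorted entries are 0, 1, 0, 1, ... modulo 2. *)
Definition misplaced (i : nat) : bool := odd (a i + below (a i))%N.
Definition defect : nat := (\sum_(i < k) misplaced i)%N.

(** The effect of a further entry v on the sign and on the defect ([vsign_recr],
    [defect_recr]): the entries above v move up by one in rank, hence the
    exclusive or. *)
Definition insert_sign (v : nat) : int := \prod_(i < k) sgz (v%:Z - (a i)%:Z).
Definition insert_defect (v : nat) : nat :=
  (\sum_(i < k) (misplaced i (+) (v < a i)) + odd (v + below v))%N.

Lemma vsign_eq0 i j : (i < j < k)%N -> a i = a j -> vsign = 0.
Proof.
case/andP=> lt_ij lt_jk aij.
by rewrite /vsign (bigD1 (Ordinal lt_jk)) //= (bigD1 (Ordinal lt_ij)) //= aij subrr sgz0 !mul0r.
Qed.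

Lemma injective_uptoPn :
  injective_upto \/ exists i j, (i < j < k)%N /\ a i = a j.
Proof.
have [inj|] := boolP [forall i : 'I_k, forall j : 'I_k, (a i == a j) ==> (i == j)].
  left=> i j lt_ik lt_jk aij; move/forallP/(_ (Ordinal lt_ik))/forallP: inj.
  by move/(_ (Ordinal lt_jk))/implyP => /= /(_ (introT eqP aij))/eqP[].
case/forallPn=> i /forallPn[j]; rewrite negb_imply => /andP[/eqP aij neq].
right; have [lt_ij|lt_ji|/val_inj eq_ij] := ltngtP i j; last by rewrite eq_ij eqxx in neq.
  by exists i, j; rewrite lt_ij ltn_ord.
by exists j, i; rewrite lt_ji ltn_ord.
Qed.

Hypothesis inj_a : injective_upto.

Lemma below_succ i : (i < k)%N -> below (a i).+1 = (below (a i)).+1.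
Proof.
move=> lt_ik; rewrite /below (bigD1 (Ordinal lt_ik)) //=.
rewrite [in RHS](bigD1 (Ordinal lt_ik)) //= ltnS leqnn ltnn.
rewrite add0n add1n; congr _.+1; apply: eq_bigr => j /eqP neq_ji.
rewrite ltnS leq_eqVlt; case: eqP => // /(inj_a (ltn_ord j) lt_ik) ji.
by case: neq_ji; apply: val_inj.
Qed.

Lemma insert_sign_eq0 i : (i < k)%N -> insert_sign (a i) = 0.
Proof.
by move=> lt_ik; rewrite /insert_sign (bigD1 (Ordinal lt_ik)) //= subrr sgz0 mul0r.
Qed.

(** Agrees with the sum in [insert_defect] unless v is an entry; the entry v itself
    is then counted among those above v. *)
Definition gap_defect v : nat := (\sum_(i < k) (misplaced i (+) (v <= a i)))%N.
Definition potential (m v : nat) : bool := (~~ odd (v + below v) && (v + gap_defect v == m))%N.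

Lemma gap_defect_sign v : (forall i, (i < k)%N -> a i != v) ->
  insert_sign v = (-1) ^+ (defect + gap_defect v)%N.
Proof.
move=> v_new; rewrite exprD /defect /gap_defect !expr_sum -big_split /=.
apply: eq_bigr => i _; have := v_new i (ltn_ord i).
rewrite !signr_addb mulrA -expr2 sqrr_sign mul1r.
case: leqP => [le_va neq|lt_av _]; last by apply: gtr0_sgz; lia.
by apply: ltr0_sgz; lia.
Qed.

Lemma insert_defect_gap v : (forall i, (i < k)%N -> a i != v) ->
  insert_defect v = (gap_defect v + odd (v + below v))%N.
Proof.
move=> v_new; congr (_ + _)%N; apply: eq_bigr => i _.
by rewrite (leq_eqVlt v) eq_sym (negPf (v_new i (ltn_ord i))).
Qed.

Lemma gap_defect_succ v : (forall i, (i < k)%N -> a i != v) ->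
  gap_defect v.+1 = gap_defect v /\ below v.+1 = below v.
Proof.
move=> v_new; split; apply: eq_bigr => i _; have := v_new i (ltn_ord i) => neq.
  by congr (nat_of_bool (_ (+) _)); lia.
by congr nat_of_bool; lia.
Qed.

(** If v is not an entry, then v and v.+1 would be inserted at the same rank, so
    one of the two potentials is 0; which one depends on whether v is misplaced,
    and the sign changes accordingly.  If v is an entry, then the term of v is 0,
    and v.+1 would be inserted one rank higher, with a gap defect that is lower by
    one unless v is misplaced; both facts leave the potential unchanged. *)
Lemma insertion_telescope m v :
  (-1) ^+ insert_defect v * (insert_defect v + v == m)%N%:R * insert_sign v
  = (-1) ^+ defect * ((potential m v)%:R - (potential m v.+1)%:R).
Proof.
have [/existsP[i /eqP ai]|] := boolP [exists i : 'I_k, a i == v].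
  rewrite -ai insert_sign_eq0 // mulr0 /potential below_succ //.
  have -> : ((a i).+1 + (below (a i)).+1 = (a i + below (a i)).+2)%N by lia.
  rewrite /= !negbK -/(misplaced i); case: (boolP (misplaced i)) => [_|right_i].
    by rewrite subrr mulr0.
  have -> : gap_defect (a i) = (gap_defect (a i).+1).+1.
    rewrite /gap_defect (bigD1 i) //= [in RHS](bigD1 i) //= (negPf right_i) leqnn ltnn /= add1n.
    congr _.+1; apply: eq_bigr => j neq_ji; congr (nat_of_bool (_ (+) _)).
    have : a j <> a i by move/inj_a => /(_ (ltn_ord j) (ltn_ord i)) /val_inj/eqP; apply/negP.
    by lia.
  by rewrite addSn addnS subrr mulr0.
move/existsPn=> new; have v_new i : (i < k)%N -> a i != v.
  by move=> lt_ik; apply: (new (Ordinal lt_ik)).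
rewrite gap_defect_sign // insert_defect_gap //.
have [gapS belowS] := gap_defect_succ v_new.
rewrite /potential gapS belowS !addSn /= negbK !exprD.
have sq : (-1) ^+ gap_defect v * (-1) ^+ gap_defect v = 1 :> int.
  by rewrite -exprD addnn -muln2 exprM sqrr_sign.
move: sq; set e := _ ^+ gap_defect v; set d := _ ^+ defect => sq.
case: (odd _) => /=.
  have -> : ((gap_defect v + 1 + v)%N == m) = ((v + gap_defect v).+1 == m).
    by congr (_ == m); lia.
  set c := (_ == m)%:R; transitivity (e * e * - (d * c)); first by ring.
  by rewrite sq; ring.
have -> : ((gap_defect v + 0 + v)%N == m) = ((v + gap_defect v)%N == m).
  by congr (_ == m); lia.
set c := (_ == m)%:R; transitivity (e * e * (d * c)); first by ring.
by rewrite sq; ring.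
Qed.

(** The potential vanishes beyond m, and at 0 all entries are above the gap, which
    exchanges the misplaced ones with the others. *)
Lemma insertion_sum m :
  \sum_(v < m.+1) (-1) ^+ (m - v) * (insert_defect v + v == m)%N%:R * insert_sign v
  = (-1) ^+ defect * (defect + m == k)%N%:R.
Proof.
under eq_bigr => v _.
  have -> : (-1) ^+ (m - v) * (insert_defect v + v == m)%N%:R =
            (-1) ^+ insert_defect v * (insert_defect v + v == m)%N%:R :> int.
    by case: eqP => [mE|_]; rewrite ?mulr0 // -(addnK v (insert_defect v)) mE.
  rewrite insertion_telescope; over.
rewrite -big_distrr /= -(big_mkord xpredT (fun v => (potential m v)%:R - (potential m v.+1)%:R)) /=.
under eq_bigr do rewrite -opprB.
rewrite sumrN telescope_sumr // opprB; congr (_ * _).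
have -> : potential m m.+1 = false by apply/negP => /andP[_ /eqP]; lia.
rewrite subr0 /potential add0n.
have -> : below 0 = 0%N by apply: big1.
have /= : (gap_defect 0 + defect = k)%N.
  rewrite /gap_defect /defect -big_split -[RHS]card_ord -sum1_card /=.
  by apply: eq_bigr => i _; case: misplaced.
by move=> <-; congr ((_ : bool)%:R); lia.
Qed.

End Insertion.

Lemma eq_vsign k a b : (forall i, (i < k)%N -> a i = b i) -> vsign k a = vsign k b.
Proof.
move=> ab; apply: eq_bigr => j _; apply: eq_bigr => i _.
by rewrite !ab // (ltn_trans (ltn_ord i)).
Qed.

Lemma eq_below k a b v : (forall i, (i < k)%N -> a i = b i) -> below k a v = below k b v.
Proof. by move=> ab; apply: eq_bigr => j _; rewrite ab. Qed.

Lemma eq_defect k a b : (forall i, (i < k)%N -> a i = b i) -> defect k a = defect k b.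
Proof.
by move=> ab; apply: eq_bigr => j _; rewrite /misplaced ab // (eq_below _ ab).
Qed.

Lemma eq_insert_sign k a b v : (forall i, (i < k)%N -> a i = b i) ->
  insert_sign k a v = insert_sign k b v.
Proof. by move=> ab; apply: eq_bigr => j _; rewrite ab. Qed.

Lemma eq_insert_defect k a b v : (forall i, (i < k)%N -> a i = b i) ->
  insert_defect k a v = insert_defect k b v.
Proof.
move=> ab; rewrite /insert_defect (eq_below _ ab); congr (_ + _)%N.
by apply: eq_bigr => j _; rewrite /misplaced ab // (eq_below _ ab).
Qed.

Lemma vsign_recr k a : vsign k.+1 a = vsign k a * insert_sign k a (a k).
Proof. by rewrite /vsign big_ord_recr. Qed.

Lemma defect_recr k a : defect k.+1 a = insert_defect k a (a k).
Proof.
rewrite /defect /insert_defect big_ord_recr /= /misplaced /below big_ord_recr /= ltnn addn0.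
congr (_ + _)%N; apply: eq_bigr => i _; rewrite big_ord_recr /=.
by rewrite addnA oddD; case: (a k < a i)%N.
Qed.

(** Reduces the effect of a permutation on the sign to that on a determinant. *)
Lemma vsign_det k a :
  vsign k a = sgz (\det (Vandermonde k (\row_(i < k) (a i)%:Z))).
Proof.
rewrite det_Vandermonde (big_morph (@sgz int) (@sgzM _) (@sgz1 _)) /vsign.
transitivity (\prod_(j < k) \prod_(i < k | (i < j)%N) sgz ((a j)%:Z - (a i)%:Z)).
  apply: eq_bigr => j _.
  exact: (big_ord_widen k (fun i => sgz ((a j)%:Z - (a i)%:Z)) (ltnW (ltn_ord j))).
rewrite (exchange_big_dep xpredT) //=; apply: eq_bigr => i _.
rewrite (big_morph (@sgz int) (@sgzM _) (@sgz1 _)); apply: eq_bigr => j _.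
by rewrite !mxE.
Qed.

Section Permuted.
Context (k : nat) (a b : nat -> nat) (s : 'S_k).
Hypothesis ab : forall i : 'I_k, b i = a (s i).

Lemma vsign_perm : vsign k b = (-1) ^+ s * vsign k a.
Proof.
rewrite !vsign_det.
have -> : Vandermonde k (\row_(i < k) (b i)%:Z) =
          col_perm s (Vandermonde k (\row_(i < k) (a i)%:Z)).
  by apply/matrixP => i j; rewrite !mxE ab.
rewrite col_permE det_mulmx det_perm odd_permV sgzM mulrC.
by case: (odd_perm s); rewrite ?expr1 ?expr0 ?sgz1 ?sgzN1.
Qed.

Lemma below_perm v : below k b v = below k a v.
Proof.
rewrite /below [in RHS](reindex_inj (@perm_inj _ s)) /=.
by apply: eq_bigr => i _; rewrite ab.
Qed.

Lemma defect_perm : defect k b = defect k a.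
Proof.
rewrite /defect [in RHS](reindex_inj (@perm_inj _ s)) /=.
by apply: eq_bigr => i _; rewrite /misplaced ab below_perm.
Qed.

End Permuted.

Lemma misplaced_gt0 k a i : misplaced k a i -> (0 < a i)%N.
Proof.
rewrite /misplaced; case: (a i) => // ; rewrite /below big1 //.
Qed.

(** Lowering some entries by one cannot exchange two of them.  If no two become
    equal, all ranks are preserved, so that an entry of b is well placed exactly
    when S selects it if and only if it is misplaced in a.  If two become equal,
    they were neighbours a q = a p + 1 of consecutive ranks, either both misplaced
    or both not, whereas S selects only q. *)
Lemma vsign_hop k a b (S : pred nat) :
    injective_upto k a -> (forall i, (i < k)%N -> a i = (b i + S i)%N) ->
  vsign k b * (defect k b == 0%N)%:R =
  vsign k a * [forall i : 'I_k, S i == misplaced k a i]%:R.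
Proof.
move=> inj_a ab.
have [inj_b|] := injective_uptoPn k b; last first.
  have [//|[i [j [lt_ijk bij]]]] := injective_uptoPn k b.
    by move=> inj_b [i [j [/andP[lt_ij lt_jk] bij]]]; have := inj_b i j; lia.
  rewrite (vsign_eq0 lt_ijk bij) mul0r => _.
  rewrite [X in _ * X](_ : _ = 0) ?mulr0 //; case: forallP => // SE.
  have [p [q [lt_pk lt_qk [bpq Sp Sq]]]] :
      exists p q, [/\ (p < k)%N, (q < k)%N & [/\ b p = b q, S p = false & S q = true]].
    have := ab i; have := ab j; have := inj_a i j; move/andP: lt_ijk => [lt_ij lt_jk].
    have lt_ik := ltn_trans lt_ij lt_jk.
    case Si: (S i); case Sj: (S j) => inj_ij aj ai; try by exfalso; lia.
      by exists j, i; split.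
    by exists i, j; split.
  have aq : a q = (a p).+1 by rewrite (ab p) // (ab q) // bpq Sp Sq addn0 addn1.
  have /eqP := SE (Ordinal lt_pk); have /eqP := SE (Ordinal lt_qk).
  rewrite /= Sp Sq /misplaced aq below_succ // addSn addnS /= negbK => <-.
  by [].
have le_ab i j : (i < k)%N -> (j < k)%N -> (a i < a j)%N = (b i < b j)%N.
  move=> lt_ik lt_jk; have := ab i lt_ik; have := ab j lt_jk.
  have := inj_a i j lt_ik lt_jk; have := inj_b i j lt_ik lt_jk.
  have [->|neq_ij] := eqVneq i j; first by lia.
  by case: (S i); case: (S j) => /=; lia.
have -> : vsign k a = vsign k b.
  apply: eq_bigr => j _; apply: eq_bigr => i _.
  have lt_ik := ltn_trans (ltn_ord i) (ltn_ord j).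
  have := le_ab _ _ lt_ik (ltn_ord j); have := le_ab _ _ (ltn_ord j) lt_ik.
  have := inj_a i j lt_ik (ltn_ord j); have := inj_b i j lt_ik (ltn_ord j).
  have := ltn_ord i.
  case: (ltngtP (a i) (a j)) => [lt_aij|gt_aij|eq_aij]; last by lia.
    by move=> *; rewrite !gtr0_sgz //; lia.
  by move=> *; rewrite !ltr0_sgz //; lia.
congr (_ * (_ : bool)%:R); rewrite /defect sum_nat_eq0; apply: eq_forallb => i.
have -> : misplaced k a i = misplaced k b i (+) S i.
  rewrite /misplaced (ab i) //.
  have -> : below k a (b i + S i)%N = below k b (b i).
    by rewrite -(ab i) //; apply: eq_bigr => j _; rewrite le_ab.
  by rewrite addnAC oddD oddb.
by case: (misplaced k b i); case: (S i).
Qed.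

Section Increasing.
Context (k : nat) (a : nat -> nat).
Hypothesis incr_a : forall i j, (i < j < k)%N -> (a i < a j)%N.

Lemma vsign_increasing : vsign k a = 1.
Proof.
apply: big1 => j _; apply: big1 => i _.
have := incr_a (i := i) (j := j); rewrite !ltn_ord => /(_ isT) lt_a.
by apply: gtr0_sgz; lia.
Qed.

Lemma defect_increasing : defect k a = (\sum_(i < k) odd (a i + i))%N.
Proof.
apply: eq_bigr => i _; rewrite /misplaced; congr (nat_of_bool (odd (_ + _))).
rewrite /below -[RHS](card_ord i) -sum1_card.
rewrite (big_ord_widen k (fun=> 1%N) (ltnW (ltn_ord i))) [RHS]big_mkcond /=.
apply: eq_bigr => j _; have := ltn_ord j; have := ltn_ord i.
have [lt_ji|lt_ij|->] := ltngtP j i => lti ltj; last by rewrite ltnn.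
  by rewrite incr_a ?lt_ji.
by have := @incr_a i j; rewrite lt_ij ltj => /(_ isT); case: ltngtP.
Qed.

End Increasing.

(** * Elementary symmetric functions *)

Section Elementary.
Context (n : nat) (R : comNzRingType).
Implicit Types (f c d : mfps n R) (A S : {set 'I_n}).
Local Notation x := (@fpsX n R).

Definition elem_sym A s : mfps n R :=
  \sum_(S : {set 'I_n} | (S \subset A) && (#|S| == s)) \prod_(i in S) x i.

Lemma prod_fpsX S : \prod_(i in S) x i = fps_monom R (mesym1 S).
Proof.
have -> : mesym1 S = (\sum_(i in S) U_(i))%MM.
  apply/mnmP => i; rewrite mnmE mnm_sumE.
  have [iS|niS] := boolP (i \in S).
    rewrite (bigD1 i) //= mnm1E eqxx big1 // => j /andP[_ /negPf neq].
    by rewrite mnm1E neq.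
  by rewrite big1 // => j jS; rewrite mnm1E; case: eqP jS niS => // -> ->.
by rewrite fps_monom_sum.
Qed.

(** With both coefficients free, this covers the factors 1 - x_k x_i and x_k - x_i of
    the Littlewood identity as well as the factors 1 + t_k x_j of the letters. *)
Lemma prod_linear A c d :
  \prod_(i in A) (d + c * x i) =
  \sum_(S : {set 'I_n} | S \subset A) c ^+ #|S| * d ^+ (#|A| - #|S|) * \prod_(i in S) x i.
Proof.
pose F i := if i \in A then c * x i else 0.
pose G i := if i \in A then d else 1.
transitivity (\prod_i (F i + G i)).
  rewrite big_mkcond; apply: eq_bigr => i _; rewrite /F /G.
  by case: (i \in A); rewrite ?add0r // addrC.
rewrite bigA_distr [RHS]big_mkcond; apply: eq_bigr => S _.
have [sSA|/subsetPn[i iS niA]] := boolP (S \subset A); last first.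
  by rewrite (bigD1 i) //= iS /F (negPf niA) mul0r.
rewrite (bigID (mem S)) /=.
have -> : \prod_(i in S) (if i \in S then F i else G i) = c ^+ #|S| * \prod_(i in S) x i.
  rewrite -prodr_const -big_split; apply: eq_bigr => i iS.
  by rewrite iS /F (subsetP sSA _ iS).
have -> : \prod_(i | i \notin S) (if i \in S then F i else G i) = d ^+ (#|A| - #|S|).
  have <- : #|A :\: S| = (#|A| - #|S|)%N by rewrite cardsD (setIidPr sSA).
  rewrite -prodr_const big_mkcond [RHS]big_mkcond /=.
  apply: eq_bigr => i _; rewrite inE /G.
  by case: (i \in S); case: (i \in A).
by rewrite mulrAC.
Qed.

(** Any bound N beyond #|A| will do, as the further elementary symmetric functions
    are 0; this allows the range to be adapted to an exponent. *)
Lemma prod_elem_sym A c d N : (#|A| < N)%N ->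
  \prod_(i in A) (d + c * x i) =
  \sum_(s < N) c ^+ s * d ^+ (#|A| - s) * elem_sym A s.
Proof.
case: N => // N lt_AN; rewrite prod_linear.
rewrite (partition_big (fun S => inord #|S| : 'I_N.+1) xpredT) //=.
apply: eq_bigr => s _; rewrite /elem_sym big_distrr /=.
have card_lt S : S \subset A -> (#|S| < N.+1)%N.
  by move/subset_leq_card => /leq_ltn_trans; apply.
apply: eq_big => [S|].
  case: (boolP (S \subset A)) => //= sSA.
  by rewrite -val_eqE /= inordK ?card_lt.
by move=> S /andP[sSA /eqP <-]; rewrite inordK ?card_lt.
Qed.

Lemma fps_perm_elem_sym (s : {perm 'I_n}) A k : (forall i, (s i \in A) = (i \in A)) ->
  fps_perm s (elem_sym A k) = elem_sym A k.
Proof.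
move=> sA; rewrite /elem_sym fps_perm_sum.
have inj_s : injective (fun S : {set 'I_n} => s @: S) by apply: imset_inj; apply: perm_inj.
rewrite [RHS](reindex_inj inj_s) /=; apply: eq_big => S.
  rewrite (card_imset _ (@perm_inj _ s)); congr (_ && _).
  apply/subsetP/subsetP => sS i.
    by move=> /imsetP[j jS ->]; rewrite sA sS.
  by move=> iS; rewrite -sA sS ?imset_f.
move=> _; rewrite fps_perm_prod big_imset /=; last by move=> i j _ _; apply: perm_inj.
by apply: eq_bigr => i _; rewrite fps_permX.
Qed.

End Elementary.

(** * Littlewood's identity *)

Section Littlewood.
Context (n' : nat) (R : comNzRingType).
Local Notation n := n'.+1.

(** Turns antisymmetry into the vanishing of coefficients at vectors with two equal
    exponents. *)
Hypothesis no_2torsion : forall c : R, c = - c -> c = 0.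
Implicit Types (m : 'X_{1..n}) (f : mfps n R).
Local Notation x i := (fpsX R (inord i : 'I_n)).

Definition vars k : {set 'I_n} := [set i : 'I_n | i < k]%N.
Definition expo m (i : nat) : nat := m (inord i).
Definition supported k m := [forall i : 'I_n, (k <= i)%N ==> (m i == 0%N)].

(** In defect 0 this will turn out to be the expansion, in the first k variables, of
    the Vandermonde product divided by the product of the 1 - x_i x_j for i <= j;
    the other defects arise in the induction on k. *)
Definition defect_series k s : mfps n R := fun m =>
  (supported k m)%:R * (vsign k (expo m) * (defect k (expo m) == s)%:R)%:~R.

Lemma card_vars k : (k <= n)%N -> #|vars k| = k.
Proof.
move=> le_kn; rewrite -sum1dep_card -(big_ord_widen _ (fun=> 1%N) le_kn).
by rewrite sum1_card card_ord.
Qed.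

Lemma fps_perm_defect_series k s i j : (k <= n)%N -> (i < k)%N -> (j < k)%N -> i <> j ->
  fps_perm (tperm (inord i) (inord j)) (defect_series k s) = - defect_series k s.
Proof.
move=> le_kn lt_ik lt_jk neq_ij; apply: funext => m; rewrite /fps_perm.
have -> : (- defect_series k s) m = - (defect_series k s m) by [].
rewrite /defect_series.
set m' := [multinom _ | _ < _].
have lt_in := leq_trans lt_ik le_kn; have lt_jn := leq_trans lt_jk le_kn.
have -> : supported k m' = supported k m.
  apply: eq_forallb => l; case: (leqP k l) => //= le_kl.
  by rewrite mnmE tpermD // -val_eqE /= inordK //; apply/eqP; lia.
have mm' : forall l : 'I_k, expo m' l = expo m (tperm (Ordinal lt_ik) (Ordinal lt_jk) l).
  move=> l; rewrite /expo mnmE; congr (m _); apply: val_inj.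
  have lt_ln := leq_trans (ltn_ord l) le_kn.
  rewrite !permE /= -!val_eqE /= !inordK //; last by do 2?case: eqP => _.
  by case: eqP => _ /=; rewrite ?inordK //; case: eqP => _ /=; rewrite ?inordK.
have vE := vsign_perm mm'; have dE := defect_perm mm'.
rewrite vE dE odd_tperm.
rewrite -val_eqE /=; case: eqP => // _.
by rewrite expr1 mulN1r mulNr rmorphN mulrN.
Qed.

Lemma coef_elem_symM f A s m :
  (f * elem_sym R A s : mfps n R) m =
  \sum_(S : {set 'I_n} | (S \subset A) && (#|S| == s))
    if (mesym1 S <= m)%MM then f (m - mesym1 S)%MM else 0.
Proof.
rewrite /elem_sym big_distrr fps_sumE /=; apply: eq_bigr => S _.
by rewrite prod_fpsX fps_mul_monomE.
Qed.

Lemma mesym1_lem (S : {set 'I_n}) m :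
  (mesym1 S <= m)%MM = [forall i, (i \in S) ==> (0 < m i)%N].
Proof.
apply/mnm_lepP/forallP => [le_Sm i|gt0_m i].
  by apply/implyP => iS; have := le_Sm i; rewrite mnmE iS.
by rewrite mnmE; case: (boolP (i \in S)) (gt0_m i).
Qed.

(** At an injective exponent vector, [vsign_hop] leaves the set W of the misplaced
    entries as the only subset that contributes.  If two exponents are equal, both
    sides vanish by antisymmetry. *)
Lemma defect_series_elem_sym k s : (k <= n)%N ->
  defect_series k 0 * elem_sym R (vars k) s = defect_series k s.
Proof.
move=> le_kn; apply: funext => m.
have [inj_m|[i [j [/andP[lt_ij lt_jk] mij]]]] := injective_uptoPn k (expo m); last first.
  have lt_ik := ltn_trans lt_ij lt_jk.
  have lt_in := leq_trans lt_ik le_kn; have lt_jn := leq_trans lt_jk le_kn.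
  rewrite [in RHS]/defect_series (@vsign_eq0 k (expo m) i j) ?lt_ij // mul0r mulr0.
  set G := _ * _; set t := tperm (inord i) (inord j) : {perm 'I_n}.
  have tG : fps_perm t G = - G.
    rewrite fps_permM fps_perm_defect_series ?fps_perm_elem_sym ?mulNr //; last by lia.
    move=> l; rewrite !inE /t; case: tpermP => // ->; rewrite !inordK //.
      by rewrite lt_ik lt_jk.
    by rewrite lt_ik lt_jk.
  apply: no_2torsion; rewrite -[in LHS](opprK G) -tG.
  have -> : (- fps_perm t G) m = - (fps_perm t G m) by [].
  congr (- _); rewrite /fps_perm; congr (G _); apply/mnmP => l; rewrite mnmE.
  by rewrite /t; case: tpermP => // ->.
rewrite coef_elem_symM /defect_series.
have [supp_m|nsupp_m] := boolP (supported k m); last first.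
  rewrite mul0r big1 // => S /andP[/subsetP sSk _]; case: ifP => // le_Sm.
  suff -> : supported k (m - mesym1 S)%MM = false by rewrite mul0r.
  apply: contraNF nsupp_m => /forallP supp; apply/forallP => i; apply/implyP => le_ki.
  have := supp i; rewrite le_ki mnmBE mnmE /=; case: (boolP (i \in S)) => [/sSk|_].
    by rewrite inE ltnNge le_ki.
  by rewrite subn0.
pose W := [set i : 'I_n | (i < k)%N && misplaced k (expo m) i].
have cardW : #|W| = defect k (expo m).
  rewrite /defect (big_ord_widen n (fun i => misplaced k (expo m) i : nat) le_kn).
  by rewrite -sum1dep_card big_mkcondr; apply: eq_bigr => i _; case: misplaced.
have le_Wm : (mesym1 W <= m)%MM.
  rewrite mesym1_lem; apply/forallP => i; apply/implyP; rewrite inE => /andP[_].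
  by move/misplaced_gt0; rewrite /expo inord_val.
transitivity (\sum_(S : {set 'I_n} | (S \subset vars k) && (#|S| == s))
   (vsign k (expo m) * (S == W)%:R)%:~R : R).
  apply: eq_bigr => S /andP[/subsetP sSk cardS].
  case: ifPn => [le_Sm|nle_Sm]; last first.
    by case: eqP nle_Sm => [->|]; rewrite ?le_Wm ?mulr0.
  have -> : supported k (m - mesym1 S)%MM.
    apply/forallP => i; apply/implyP => le_ki; rewrite mnmBE.
    by have /forallP/(_ i) := supp_m; rewrite le_ki => /eqP ->.
  rewrite mul1r; congr (_%:~R).
  rewrite (vsign_hop (S := fun i => inord i \in S) inj_m); last first.
    move=> i lt_ik; rewrite /expo mnmBE mnmE subnK //.
    by have /mnm_lepP/(_ (inord i)) := le_Sm; rewrite mnmE.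
  congr (_ * (_ : bool)%:R); apply/forallP/eqP => [SE|-> i].
    apply/setP => i; rewrite inE; case: (ltnP i k) => [lt_ik|le_ki].
      by have /eqP := SE (Ordinal lt_ik); rewrite /= inord_val.
    by apply/negP => /sSk; rewrite inE ltnNge le_ki.
  by rewrite inE inordK ?ltn_ord //; apply: leq_trans le_kn.
rewrite mul1r -cardW.
have [cardE|neq] := eqVneq #|W| s.
  rewrite (bigD1 W) /=; last first.
    by rewrite cardE eqxx andbT; apply/subsetP => i; rewrite !inE => /andP[].
  by rewrite eqxx big1 ?addr0 // => S /andP[_ /negPf ->]; rewrite mulr0.
rewrite mulr0 big1 // => S /andP[_ /eqP cardS].
by case: eqP => [SW|]; rewrite ?mulr0 //; rewrite -SW cardS eqxx in neq.
Qed.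

Lemma fps_mulXnE f k s m : (k < n)%N ->
  (f * x k ^+ s) m = if (s <= m (inord k))%N then f (m - U_(inord k) *+ s)%MM else 0.
Proof.
move=> lt_kn; have -> : x k ^+ s = fps_monom R (U_(inord k) *+ s)%MM.
  elim: s => [|s IHs]; first by rewrite mulm0n fps_monom0.
  by rewrite exprSr IHs mulmSr fps_monomD.
rewrite fps_mul_monomE; congr (if _ then _ else _).
apply/mnm_lepP/idP => [/(_ (inord k))|le_s i]; first by rewrite mulmnE mnm1E eqxx mul1n.
by rewrite mulmnE mnm1E; case: eqP => [<-|]; rewrite ?mul1n.
Qed.

Lemma fps_signM f s m : ((-1) ^+ s * f) m = (-1) ^+ s * f m.
Proof.
have -> : (-1) ^+ s = fpsC ((-1) ^+ s) :> mfps n R.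
  rewrite -fpsC_exp; congr (_ ^+ _); apply: funext => u.
  have -> : (-1 : mfps n R) u = - (fpsC 1 u) by [].
  by rewrite /fpsC; case: eqP; rewrite ?oppr0.
by rewrite fpsCM.
Qed.

Lemma expo_subX k m s : (k < n)%N -> (s <= m (inord k))%N ->
  let m' := (m - U_(inord k) *+ s)%MM in
  [/\ forall i, (i < k)%N -> expo m' i = expo m i,
      expo m' k = (expo m k - s)%N & supported k.+1 m' = supported k.+1 m].
Proof.
move=> lt_kn le_s; split=> [i lt_ik||].
- rewrite /expo mnmBE mulmnE mnm1E -val_eqE /= !inordK ?(ltn_trans lt_ik) //.
  by rewrite gtn_eqF //= mul0n subn0.
- by rewrite /expo mnmBE mulmnE mnm1E eqxx mul1n.
apply: eq_forallb => i; case: (ltnP k i) => //= lt_ki.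
by rewrite mnmBE mulmnE mnm1E -val_eqE /= inordK // (ltn_eqF lt_ki) mul0n subn0.
Qed.

Lemma supported_succ k m : (k < n)%N ->
  supported k m = supported k.+1 m && (expo m k == 0%N).
Proof.
move=> lt_kn; apply/forallP/andP => [supp|[/forallP supp mk0] i].
  split; last by have := supp (inord k); rewrite inordK ?leqnn.
  by apply/forallP => i; apply/implyP => /ltnW le_ki; have := supp i; rewrite le_ki.
apply/implyP; rewrite leq_eqVlt => /orP[/eqP ki|lt_ki].
  by move: mk0; rewrite /expo ki inord_val.
by have := supp i; rewrite lt_ki.
Qed.

Lemma defect_le k a : (defect k a <= k)%N.
Proof.
rewrite -[leqRHS](card_ord k) -sum1_card; apply: leq_sum => i _.
by case: misplaced.
Qed.

(** By [defect_series_elem_sym], the left side is the sum of the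
    (- x_k)^s times the series of defect s in k + 1 variables, the right side the
    sum of the (-1)^s x_k^(k-s) times the series of defect s in k variables.  The
    coefficient of the former at m is a sum over the exponent v = m_k - s that is
    left for x_k, which [insertion_sum] evaluates. *)
Lemma defect_series_step k : (k < n)%N ->
  defect_series k.+1 0 * \prod_(i in vars k.+1) (1 - x k * fpsX R i) =
  defect_series k 0 * \prod_(i in vars k) (x k - fpsX R i).
Proof.
move=> lt_kn; apply: funext => m.
pose target : R := (supported k.+1 m)%:R *
  (vsign k (expo m) * ((-1) ^+ defect k (expo m) * (defect k (expo m) + expo m k == k)%N%:R))%:~R.
transitivity target.
  (* N exceeds both the number of variables and the exponent of x_k. *)
  pose N := (m (inord k) + k.+2)%N.
  under eq_bigr do rewrite -mulNr.
  rewrite (@prod_elem_sym _ _ _ _ _ N); last by rewrite card_vars // /N; lia.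
  rewrite big_distrr fps_sumE /=.
  transitivity (\sum_(s < N | (s < (expo m k).+1)%N)
     ((supported k.+1 m)%:R * (vsign k (expo m) *
       ((-1) ^+ s * (insert_defect k (expo m) (expo m k - s) == s)%:R *
          insert_sign k (expo m) (expo m k - s)))%:~R : R)).
    rewrite [RHS]big_mkcond; apply: eq_bigr => s _.
    rewrite expr1n mulr1 [(- x k) ^+ _]exprNn.
    have -> (f a b c : mfps n R) : f * (a * b * c) = a * (f * c * b) by ring.
    rewrite defect_series_elem_sym // fps_signM fps_mulXnE // ltnS.
    case: ifP => [le_s|_]; last by rewrite mulr0.
    have [mE mkE sE] := expo_subX lt_kn le_s.
    rewrite /defect_series sE vsign_recr defect_recr mkE.
    rewrite (eq_vsign mE) (eq_insert_sign _ mE) (eq_insert_defect _ mE).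
    by rewrite !(rmorphM, rmorphXn, rmorphN, rmorph1) /=; ring.
  rewrite -(big_ord_widen _ (fun s : nat => (supported k.+1 m)%:R * (vsign k (expo m) *
       ((-1) ^+ s * (insert_defect k (expo m) (expo m k - s) == s)%:R *
          insert_sign k (expo m) (expo m k - s)))%:~R : R)); last by rewrite /N /expo; lia.
  rewrite -big_distrr -rmorph_sum -big_distrr /=; congr (_ * _%:~R).
  have [inj_m|[i [j [lt_ijk mij]]]] := injective_uptoPn k (expo m); last first.
    by rewrite (vsign_eq0 lt_ijk mij) !mul0r.
  rewrite -insertion_sum //; congr (_ * _); rewrite (reindex_inj rev_ord_inj) /=.
  apply: eq_bigr => v _; rewrite subSS subKn; last by rewrite -ltnS.
  by congr (_ * (_ : bool)%:R * _); have := ltn_ord v; lia.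
under eq_bigr do rewrite -mulN1r.
rewrite (@prod_elem_sym _ _ _ _ _ k.+1) ?card_vars ?(ltnW lt_kn) // big_distrr fps_sumE /=.
have lt_dk : (defect k (expo m) < k.+1)%N by rewrite ltnS defect_le.
symmetry; transitivity (\sum_(s < k.+1)
   (supported k.+1 m)%:R * (vsign k (expo m) *
     ((-1) ^+ s * (defect k (expo m) == s)%:R * (s + expo m k == k)%N%:R))%:~R : R).
  apply: eq_bigr => s _.
  have -> (f a b c : mfps n R) : f * (a * b * c) = a * (f * c * b) by ring.
  rewrite defect_series_elem_sym 1?ltnW // fps_signM fps_mulXnE //.
  have le_sk : (s <= k)%N by rewrite -ltnS.
  case: ifP => [le_s|nle_s]; last first.
    rewrite (_ : (s + expo m k == k)%N = false) ?mulr0 ?mulr0 //.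
    by move: nle_s; rewrite /expo; lia.
  have [mE mkE sE] := expo_subX lt_kn le_s.
  rewrite /defect_series supported_succ // sE mkE (eq_vsign mE) (eq_defect mE).
  have -> : (expo m k - (k - s) == 0)%N = (s + expo m k == k)%N.
    by move: le_s; rewrite /expo; lia.
  rewrite -mulnb natrM !(rmorphM, rmorphXn, rmorphN, rmorph1) /= !natz.
  by ring.
rewrite (bigD1 (Ordinal lt_dk)) //= eqxx mulr1 big1 ?addr0 // => s neq.
by rewrite (_ : (_ == _) = false) ?mulr0 ?mul0r ?mulr0 //; apply/negP => /eqP sE;
  case/eqP: neq; apply: val_inj.
Qed.

Lemma defect_series0 : defect_series 0 0 = 1.
Proof.
apply: funext => m; have -> : (1 : mfps n R) m = (m == 0%MM)%:R.
  by rewrite /GRing.one /= /fpsC; case: eqP.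
rewrite /defect_series /vsign /defect !big_ord0 [X in _ * X](_ : _ = 1) ?mulr1 //.
congr ((_ : bool)%:R); apply/forallP/eqP => [supp|-> i]; last by rewrite mnm0E.
by apply/mnmP => i; apply/eqP; rewrite mnm0E; apply: (implyP (supp i)).
Qed.

Theorem littlewood :
  defect_series n 0 * \prod_(j < n) \prod_(i < n | (i <= j)%N) (1 - fpsX R j * fpsX R i) =
  \prod_(j < n) \prod_(i < n | (i < j)%N) (fpsX R j - fpsX R i).
Proof.
have partial k : (k <= n)%N ->
    defect_series k 0 * \prod_(j < k) \prod_(i in vars j.+1) (1 - x j * fpsX R i) =
    \prod_(j < k) \prod_(i in vars j) (x j - fpsX R i).
  elim: k => [|k IHk] lt_kn; first by rewrite defect_series0 !big_ord0 mulr1.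
  rewrite !big_ord_recr /= mulrCA defect_series_step // mulrA.
  by rewrite (mulrC _ (defect_series k 0)) IHk // ltnW.
transitivity (defect_series n 0 * \prod_(j < n) \prod_(i in vars j.+1) (1 - x j * fpsX R i)).
  congr (_ * _); apply: eq_bigr => j _; apply: eq_big => i; first by rewrite inE.
  by rewrite inord_val.
rewrite partial //; apply: eq_bigr => j _; apply: eq_big => i; first by rewrite inE.
by rewrite inord_val.
Qed.

End Littlewood.

(** * Sums over chains *)

Section Chains.
Context (R : comNzRingType) (Y : finType) (V : nat -> Y -> R) (inv : pred Y)
  (P : nat -> Y -> Y -> bool) (w : nat -> Y -> Y -> R).
Hypothesis invP : forall k y z, P k y z -> inv z.
Hypothesis VS : forall k y, inv y -> V k.+1 y = \sum_(z | P k y z) w k y z * V k z.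

(** The default value is the state above all those that p records. *)
Definition level N (p : {ffun 'I_N -> Y}) (y : Y) (k : nat) : Y :=
  oapp p y (insub k).

Lemma levelE N (p : {ffun 'I_N -> Y}) y (i : 'I_N) : level p y i = p i.
Proof. by rewrite /level valK. Qed.

Lemma level_top N (p : {ffun 'I_N -> Y}) y k : (N <= k)%N -> level p y k = y.
Proof. by move=> le_Nk; rewrite /level insubN // -leqNgt. Qed.

(** Unfolds the recursion VS down to level 0. *)
Lemma chain_sum N y : inv y ->
  V N y = \sum_(p : {ffun 'I_N -> Y}
                 | \big[andb/true]_(k < N) P k (level p y k.+1) (level p y k))
            (\prod_(k < N) w k (level p y k.+1) (level p y k)) * V 0 (level p y 0).
Proof.
elim: N y => [|N IHN] y inv_y.
  have -> : V 0 y = \sum_(p : {ffun 'I_0 -> Y}) V 0 y.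
    by rewrite sumr_const card_ffun card_ord expn0.
  apply: eq_big => [p|p _]; first by rewrite big_ord0.
  by rewrite big_ord0 mul1r level_top.
rewrite VS //.
under eq_bigr => z Pz do rewrite (IHN z (invP Pz)) big_distrr.
rewrite pair_big_dep /=.
pose cut (p : {ffun 'I_N.+1 -> Y}) : Y * {ffun 'I_N -> Y} :=
  (p ord_max, finfun (fun i : 'I_N => p (widen_ord (leqnSn N) i))).
pose glue (q : Y * {ffun 'I_N -> Y}) : {ffun 'I_N.+1 -> Y} :=
  finfun (fun i : 'I_N.+1 => level q.2 q.1 i).
have levelS p k : (k <= N)%N -> level (cut p).2 (cut p).1 k = level p y k.
  rewrite leq_eqVlt => /orP[/eqP->|lt_kN].
    by rewrite level_top //= -(levelE p y ord_max).
  rewrite -[k]/(nat_of_ord (Ordinal lt_kN)) levelE ffunE.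
  by have /= -> := levelE p y (widen_ord (leqnSn N) (Ordinal lt_kN)).
have topE (p : {ffun 'I_N.+1 -> Y}) : (cut p).1 = level p y N.
  by have /= -> := levelE p y (@ord_max N).
have cut_bij : bijective cut.
  exists glue => [p|[z q]].
    by apply/ffunP => i; rewrite ffunE levelS ?levelE // -ltnS.
  rewrite /cut /glue !ffunE level_top //; congr pair.
  apply/ffunP => i; rewrite !ffunE.
  exact: levelE.
clearbody cut; rewrite (reindex cut) /=; last exact: onW_bij.
apply: eq_big => [p|p _].
  rewrite big_ord_recr /= (@level_top N.+1 p y N.+1) // andbC; congr (_ && _); last by rewrite topE.
  by apply: eq_bigr => k _; rewrite -!levelS // ltnW.
rewrite big_ord_recr /= (@level_top N.+1 p y N.+1) // levelS // topE.
rewrite mulrA (mulrC (w N _ _)); congr (_ * _ * _).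
by apply: eq_bigr => k _; rewrite -topE !levelS // ltnW.
Qed.

End Chains.

(** * Removing the letters one by one *)

Section Letters.
Context (n' : nat) (R : comNzRingType) (t : nat -> R).
Local Notation n := n'.+1.
Hypothesis no_2torsion : forall c : R, c = - c -> c = 0.
Implicit Types (m : 'X_{1..n}) (S : {set 'I_n}).

Definition tail_vars k : {set 'I_n} := [set j : 'I_n | k <= j]%N.

(** The factors of the letters t_0, ..., t_(k-1); x_j carries t_l only if l <= j, and this is
    what becomes the flag condition. *)
Definition letter_series k : mfps n R :=
  defect_series R n 0 * \prod_(l < k) \prod_(j in tail_vars l) (1 + fpsC (t l) * fpsX R j).

(** The factors of the letters before t_k are symmetric in x_i and x_(i+1) if
    k <= i + 1, so the product stays alternating in these two variables. *)
Lemma letter_series_eq0 k m i : (i.+1 < n)%N -> (k <= i.+1)%N ->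
  expo m i = expo m i.+1 -> letter_series k m = 0.
Proof.
move=> lt_in le_ki mi.
have lt_in0 : (i < n)%N by apply: ltnW.
pose s : {perm 'I_n} := tperm (inord i) (inord i.+1).
have sL : fps_perm s (letter_series k) = - letter_series k.
  have neq : i <> i.+1 by lia.
  rewrite /letter_series fps_permM (fps_perm_defect_series R 0 (leqnn n) lt_in0 lt_in neq) mulNr.
  congr (- (_ * _)); rewrite fps_perm_prod; apply: eq_bigr => l _.
  rewrite fps_perm_prod [RHS](reindex_inj (@perm_inj _ s)) /=.
  apply: eq_big => [j|j _].
    have lt_lk := ltn_ord l.
    rewrite !inE /s; case: tpermP => // ->; rewrite !inordK //; lia.
  by rewrite fps_permD fps_permC fps_permM fps_permC fps_permX.
apply: no_2torsion; rewrite -[in LHS](opprK (letter_series k)) -sL.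
have -> : (- fps_perm s (letter_series k)) m = - (fps_perm s (letter_series k)) m by [].
congr (- _); rewrite /fps_perm; congr (letter_series k _); apply/mnmP => j; rewrite mnmE.
by rewrite /s; case: tpermP => // ->.
Qed.

Lemma letter_series_succ k m : letter_series k.+1 m =
  \sum_(S : {set 'I_n} | S \subset tail_vars k)
    t k ^+ #|S| * (if (mesym1 S <= m)%MM then letter_series k (m - mesym1 S)%MM else 0).
Proof.
rewrite {1}/letter_series big_ord_recr /= mulrA -/(letter_series k) prod_linear.
rewrite big_distrr fps_sumE /=; apply: eq_bigr => S _.
by rewrite expr1n mulr1 fpsC_exp mulrCA fpsCM prod_fpsX fps_mul_monomE.
Qed.

(** The value at j is the number of boxes left in the column of the staircase that
    has height j.  As positions, these numbers are shifted by j: strictly increasing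
    positions correspond to weakly increasing heights. *)
Definition heights := {ffun 'I_n -> 'I_n}.
Implicit Types (h : heights).
Definition weakly_increasing h := [forall i : 'I_n, forall j : 'I_n, (i <= j)%N ==> (h i <= h j)%N].
Definition staircase_expo h : 'X_{1..n} := [multinom (j + h j)%N | j < n].

(** A horizontal strip, one box at most per column, that avoids the columns of
    height less than k. *)
Definition strip k h h' :=
  [&& weakly_increasing h',
      [forall j, (h' j <= h j <= (h' j).+1)%N] &
      [forall j : 'I_n, (j < k)%N ==> (h' j == h j)]].
Definition strip_size h h' := (\sum_j (h j - h' j))%N.

(** Expanding the factors of t_k gives a sum over the sets S of particles that move.
    A move to a configuration that is not strictly increasing puts a particle
    j >= k onto its left neighbour, which has not moved; such terms vanish by
    [letter_series_eq0].  The other sets S correspond to the strips h'. *)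
Lemma letter_series_strips k h : weakly_increasing h ->
  letter_series k.+1 (staircase_expo h) =
  \sum_(h' | strip k h h') t k ^+ strip_size h h' * letter_series k (staircase_expo h').
Proof.
move=> incr_h; rewrite letter_series_succ.
pose m := staircase_expo h.
pose shrink S : heights := finfun (fun j => inord (h j - (j \in S)) : 'I_n).
pose moved h' : {set 'I_n} := [set j | h' j < h j]%N.
pose good S :=
    [&& S \subset tail_vars k, (mesym1 S <= m)%MM & letter_series k (m - mesym1 S)%MM != 0].
have expoE S j : (mesym1 S <= m)%MM -> (m - mesym1 S)%MM j = (j + h j - (j \in S))%N.
  by move=> _; rewrite mnmBE !mnmE.
have shrinkE S j : shrink S j = (h j - (j \in S))%N :> nat.
  by rewrite ffunE inordK //; apply: leq_ltn_trans (leq_subr _ _) (ltn_ord _).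
(* If not, positions i and i.+1 are now equal because only i.+1 has moved; then
   k <= i.+1 and the term of S is 0. *)
have incr S : good S -> forall i, (i.+1 < n)%N ->
    (expo (m - mesym1 S)%MM i < expo (m - mesym1 S)%MM i.+1)%N.
  case/and3P=> /subsetP sS le_Sm nz i lt_in; have lt_in0 := ltnW lt_in.
  have hi : (h (inord i) <= h (inord i.+1))%N.
    by have /forallP/(_ (inord i))/forallP/(_ (inord i.+1)) := incr_h; rewrite !inordK // leqnSn.
  have Si := sS (inord i.+1); rewrite inE inordK // in Si.
  have := @letter_series_eq0 k _ i lt_in _ _; rewrite /expo.
  move=> /(_ (m - mesym1 S)%MM); rewrite !expoE // !inordK //.
  have /mnm_lepP/(_ (inord i)) := le_Sm; rewrite !mnmE inordK //.
  move: nz; case: (inord i.+1 \in S) Si => Si; case: (inord i \in S) => nz le_i z0 /=; try by lia.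
  have [//|ge] := ltnP.
  case/eqP: nz; apply: z0; [exact: Si| by lia].
have moved_le S j : good S -> j \in S -> (0 < h j)%N.
  move=> gS jS; have [_ le_Sm _] := and3P gS.
  (* Positions that increase strictly cannot fall below 0, 1, 2, ... *)
  have ge_i : forall i, (i < n)%N -> (i <= expo (m - mesym1 S)%MM i)%N.
    elim=> // i IHi lt_in; apply: leq_ltn_trans (IHi (ltnW lt_in)) _.
    exact: incr.
  have /mnm_lepP/(_ j) := le_Sm; rewrite !mnmE jS.
  by have := ge_i j (ltn_ord j); rewrite /expo inord_val expoE // jS; lia.
have goodE S : good S -> (m - mesym1 S)%MM = staircase_expo (shrink S).
  move=> gS; have [_ le_Sm _] := and3P gS.
  apply/mnmP => j; rewrite expoE // mnmE shrinkE.
  by case: (boolP (j \in S)) => [/(moved_le S j gS)|_]; lia.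
have mono a : (forall i, (i.+1 < n)%N -> (a i < a i.+1)%N) ->
    forall i j, (i <= j < n)%N -> (a i + j <= a j + i)%N.
  move=> incr_a i j /andP[]; elim: j => [|j IHj].
    by rewrite leqn0 => /eqP ->.
  rewrite leq_eqVlt => /orP[/eqP-> //|]; rewrite ltnS => /IHj {}IHj lt_jn.
  by have := IHj (ltnW lt_jn); have := incr_a j lt_jn; lia.
transitivity (\sum_(S | good S) t k ^+ #|S| * letter_series k (m - mesym1 S)%MM).
  rewrite big_mkcond [RHS]big_mkcond; apply: eq_bigr => S _; rewrite /good.
  case: (S \subset tail_vars k) => //=; case: (_ <= _)%MM; rewrite ?mulr0 //=.
  by case: eqP => [->|//]; rewrite mulr0.
transitivity (\sum_(h' | strip k h h' && (letter_series k (staircase_expo h') != 0))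
   t k ^+ strip_size h h' * letter_series k (staircase_expo h')); last first.
  rewrite big_mkcondr; apply: eq_bigr => h' _.
  by case: eqP => [->|//]; rewrite mulr0.
have shrink_strip S : good S -> strip k h (shrink S).
  move=> gS; have [/subsetP sS le_Sm _] := and3P gS; apply/and3P; split.
  - apply/forallP => i; apply/forallP => j; apply/implyP => le_ij.
    have := mono _ (incr _ gS) i j; rewrite le_ij ltn_ord => /(_ isT).
    by rewrite /expo !inord_val goodE // !mnmE; lia.
  - by apply/forallP => j; rewrite shrinkE; case: (j \in S); lia.
  apply/forallP => j; apply/implyP => lt_jk; apply/eqP/val_inj; rewrite /= shrinkE.
  by case: (boolP (j \in S)) => [/sS|]; rewrite ?subn0 // inE leqNgt lt_jk.
have moved_shrink S : good S -> moved (shrink S) = S.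
  move=> gS; apply/setP => j; rewrite inE shrinkE.
  by case: (boolP (j \in S)) => [/(moved_le S j gS)|]; lia.
have shrink_moved h' : strip k h h' -> shrink (moved h') = h'.
  case/and3P=> _ /forallP step _; apply/ffunP => j; apply: val_inj; rewrite /= shrinkE inE.
  by have := step j; case: ltnP; lia.
have good_moved h' : strip k h h' -> good (moved h') = (letter_series k (staircase_expo h') != 0).
  move=> st; have [_ /forallP step /forallP fixed] := and3P st.
  have le_m : (mesym1 (moved h') <= m)%MM.
    by apply/mnm_lepP => j; rewrite !mnmE inE; case: ltnP; lia.
  rewrite /good le_m (_ : _ \subset _) /=; last first.
    apply/subsetP => j; rewrite !inE; have := fixed j; case: (ltnP j k) => //=.
    by move=> _ /eqP ->; rewrite ltnn.
  suff -> : (m - mesym1 (moved h'))%MM = staircase_expo h' by [].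
  apply/mnmP => j; rewrite expoE // mnmE inE.
  by have := step j; case: ltnP => /=; lia.
rewrite (reindex_onto moved shrink) /=; last by move=> S /moved_shrink.
apply: eq_big => [h'|h' /andP[gh /eqP hE]].
  apply/andP/andP => [[gh /eqP hE]|[st nz]].
    by have := shrink_strip _ gh; rewrite hE => st; rewrite -good_moved.
  by rewrite good_moved // shrink_moved.
have st := shrink_strip _ gh; rewrite hE in st.
rewrite goodE // hE; congr (t k ^+ _ * _).
have [_ /forallP step _] := and3P st.
rewrite /strip_size -sum1_card big_mkcond; apply: eq_bigr => j _; rewrite inE.
by have := step j; case: ltnP; lia.
Qed.

End Letters.

Section Arrays.
Context (n' : nat) (R : comNzRingType) (t : nat -> R).
Local Notation n := n'.+1.
Hypothesis no_2torsion : forall c : R, c = - c -> c = 0.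
Implicit Types (h : heights n').

Definition full_heights : heights n' := [ffun j => j].

Lemma weakly_increasing_full : weakly_increasing full_heights.
Proof.
by apply/forallP => i; apply/forallP => j; apply/implyP; rewrite !ffunE.
Qed.

(** The positions j + h j are sorted, so j is its own rank and j + h j is well placed
    when h j is even. *)
Lemma letter_series0 h : weakly_increasing h ->
  letter_series t 0 (staircase_expo h) = [forall j, ~~ odd (h j)]%:R.
Proof.
move=> /forallP incr_h; rewrite /letter_series big_ord0 mulr1 /defect_series.
have expoE i : (i < n)%N -> expo (staircase_expo h) i = (i + h (inord i))%N.
  by move=> lt_in; rewrite /expo mnmE inordK.
have incr i j : (i < j < n)%N -> (expo (staircase_expo h) i < expo (staircase_expo h) j)%N.
  case/andP=> lt_ij lt_jn; have lt_in := ltn_trans lt_ij lt_jn.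
  rewrite !expoE //; have /forallP/(_ (inord j)) := incr_h (inord i).
  by rewrite !inordK // (ltnW lt_ij) /=; lia.
rewrite vsign_increasing // defect_increasing // mul1r.
have -> : supported n (staircase_expo h).
  by apply/forallP => i; rewrite leqNgt ltn_ord.
rewrite mul1r -[RHS](rmorph_nat (intmul 1)); congr ((_ : bool)%:R%:~R).
rewrite sum_nat_eq0; apply: eq_forallb => j.
by rewrite expoE // inord_val oddD oddD addbAC addbb; case: (odd (h j)).
Qed.

Lemma letter_series_arrays :
  letter_series t n (staircase_expo full_heights) =
  \sum_(p : {ffun 'I_n -> heights n'} |
      (\big[andb/true]_(k < n) strip k (level p full_heights k.+1) (level p full_heights k))
      && [forall j, ~~ odd (level p full_heights 0 j)])
    \prod_(k < n) t k ^+ strip_size (level p full_heights k.+1) (level p full_heights k).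
Proof.
have strip_incr k h h' : strip k h h' -> weakly_increasing h' by case/and3P.
rewrite (@chain_sum _ _ (fun k h => letter_series t k (staircase_expo h)) _ _ _
   strip_incr (letter_series_strips t no_2torsion) n _ weakly_increasing_full).
rewrite [RHS]big_mkcondr; apply: eq_bigr => p strips.
rewrite letter_series0; last first.
  have /andP[/and3P[]//] : strip 0 (level p full_heights 1) (level p full_heights 0) &&
     \big[andb/true]_(k < n') strip k.+1 (level p full_heights k.+2) (level p full_heights k.+1).
  by rewrite -(big_ord_recl n'
    (fun k => strip k (level p full_heights k.+1) (level p full_heights k))).
by case: forallP => _; rewrite ?mulr1 ?mulr0.
Qed.

End Arrays.

(** * The constant term *)

Section ConstantTerm.
Context (n' : nat).
Local Notation n := n'.+1.
Local Notation R := {mpoly int[n]}.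
Local Notation x := (@fpsX n R).
Local Notation tc k := (fpsC (tvar n k) : mfps n R).

Lemma mpoly_no_2torsion (c : R) : c = - c -> c = 0.
Proof.
move=> cE; apply/mpolyP => m; rewrite mcoeff0.
by have := congr1 (mcoeff m) cE; rewrite mcoeffN; lia.
Qed.

(** Both sides become the Vandermonde product after multiplication by the product of
    the 1 - x_i x_j for i <= j, which the geometric series invert; for the right
    side this is [littlewood]. *)
Lemma vandermonde_geom :
  (\prod_(i < n) \prod_(j < n | (i < j)%N) ((x j - x i) * fps_geom (x i * x j))) *
  \prod_(i < n) fps_geom (x i ^+ 2) = defect_series R n 0.
Proof.
pose D : mfps n R := \prod_(j < n) \prod_(i < n | (i < j)%N) (x j - x i).
pose G : mfps n R := (\prod_(i < n) \prod_(j < n | (i < j)%N) fps_geom (x i * x j)) *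
  \prod_(i < n) fps_geom (x i ^+ 2).
pose Q : mfps n R := \prod_(j < n) \prod_(i < n | (i <= j)%N) (1 - x j * x i).
have -> : (\prod_(i < n) \prod_(j < n | (i < j)%N) ((x j - x i) * fps_geom (x i * x j))) *
    \prod_(i < n) fps_geom (x i ^+ 2) = D * G.
  rewrite /D /G mulrA; congr (_ * _).
  rewrite [X in _ = X * _](exchange_big_dep xpredT) //= -big_split /=.
  by apply: eq_bigr => i _; rewrite -big_split.
have QG : Q * G = 1.
  have -> : Q = (\prod_(i < n) \prod_(j < n | (i < j)%N) (1 - x i * x j)) *
               \prod_(i < n) (1 - x i * x i).
    rewrite /Q [X in _ = X * _](exchange_big_dep xpredT) //= -big_split /=.
    apply: eq_bigr => j _; rewrite (bigD1 j) //= mulrC; congr (_ * _).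
    apply: eq_big => [i|i _]; last by rewrite mulrC.
    by rewrite ltn_neqAle andbC.
  rewrite /G mulrACA -!big_split /=; apply: big1 => i _.
  rewrite expr2 fps_geomXX mulr1 -big_split /=.
  by apply: big1 => j _; rewrite fps_geomXX.
by rewrite /D -(littlewood n' mpoly_no_2torsion) -mulrA QG mulr1.
Qed.

(** The statement of the constant term splits off t_0 and indexes the other letters
    by one less. *)
Lemma letters_prod :
  (\prod_(i < n) \prod_(j < n | (i < j)%N) (1 + tc i.+1 * x j)) *
  \prod_(i < n) (1 + tc 0%N * x i) =
  \prod_(k < n) \prod_(j in tail_vars n' k) (1 + tc k * x j).
Proof.
rewrite big_ord_recr [in RHS]big_ord_recl /= [X in _ * X * _]big_pred0 ?mulr1; last first.
  by move=> j; rewrite ltnNge -ltnS ltn_ord.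
rewrite mulrC; congr (_ * _).
  by apply: eq_bigl => j; rewrite inE.
apply: eq_bigr => k _; apply: eq_bigl => j.
by rewrite inE.
Qed.

Lemma Nct_letter_series : Nct n = letter_series (tvar n) n (staircase_expo (full_heights n')).
Proof.
rewrite /Nct /CT /laurent_mulX /laurent_of_fps.
have -> : [forall i : 'I_n, 0 <= (0 - [ffun i : 'I_n => - 2%:Z * i.+1%:Z + 2%:Z]) i].
  by apply/forallP => i; rewrite !ffunE; lia.
set m := [multinom _ | _ < _].
have -> : m = staircase_expo (full_heights n').
  by apply/mnmP => j; rewrite !mnmE !ffunE; lia.
congr (_ _); rewrite /letter_series -letters_prod -vandermonde_geom.
under eq_bigr => i _ do under eq_bigr => j _ do rewrite mulrAC.
under eq_bigr do rewrite big_split.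
rewrite big_split [X in _ * X]big_split /= [X in _ * X]mulrC.
by rewrite [LHS]mulrACA.
Qed.

End ConstantTerm.

(** * Arrays of column heights *)

Local Open Scope nat_scope.

Lemma sum_ltn N v : v <= N -> \sum_(i < N) (i < v) = v.
Proof.
move=> le_vN; rewrite -[RHS]card_ord -sum1_card (big_ord_widen N (fun=> 1) le_vN).
by rewrite [RHS]big_mkcond; apply: eq_bigr => i _; case: (i < v).
Qed.

(** For nondecreasing f, counting the values up to r is adjoint to f.  Applied to
    the heights of a column as a function of the letter, it describes the
    entries, and applied to the entries it recovers the heights. *)
Lemma count_le_threshold N f r i :
  (forall a b, a <= b < N -> f a <= f b) -> i < N ->
  (\sum_(a < N) (f a <= r) <= i) = (r < f i).
Proof.
move=> mono lt_iN; have [lt_r|le_r] := ltnP r (f i).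
  rewrite -[leqRHS](sum_ltn (ltnW lt_iN)); apply: leq_sum => a _.
  have [_|le_ia] := ltnP a i; first by rewrite leq_b1.
  by rewrite [f a <= r]leqNgt (leq_trans lt_r) // mono // le_ia /=.
apply/negbTE; rewrite -ltnNge -{1}(sum_ltn lt_iN); apply: leq_sum => a _.
have [le_ai|//] := ltnP a i.+1.
by rewrite (leq_trans _ le_r) // mono // -ltnS le_ai.
Qed.

Section HeightArrays.
Context (m : nat).
Local Notation n := m.+2.
Local Notation array := {ffun 'I_n -> heights m.+1}.
Implicit Types (p : array).

Definition admissible p :=
  (\big[andb/true]_(k < n) strip k (level p (full_heights m.+1) k.+1)
                                   (level p (full_heights m.+1) k))
  && [forall j, ~~ odd (level p (full_heights m.+1) 0 j)].

Definition height p k j : nat := level p (full_heights m.+1) k (inord j).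

Lemma height_top p k j : n <= k -> j < n -> height p k j = j.
Proof. by move=> le_nk lt_jn; rewrite /height level_top // ffunE inordK. Qed.

Lemma height_lt p k j : height p k j < n.
Proof. exact: ltn_ord. Qed.

Lemma admissibleP p :
  reflect [/\ forall k i j, k < n -> i <= j < n -> height p k i <= height p k j,
              forall k j, k < n -> j < n -> height p k j <= height p k.+1 j <= (height p k j).+1,
              forall k j, k < n -> j < k -> height p k j = height p k.+1 j
            & forall j, j < n -> ~~ odd (height p 0 j)] (admissible p).
Proof.
apply: (iffP andP) => [[strips evens]|[H1 H2 H3 H4]].
  have {}strips k : k < n ->
      strip k (level p (full_heights m.+1) k.+1) (level p (full_heights m.+1) k).
    move=> lt_kn; move: strips; rewrite big_andE => /forallP/(_ (Ordinal lt_kn)); exact.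
  split=> [k i j /strips/and3P[/forallP incr _ _]|k j /strips/and3P[_ /forallP step _]|k j lt_kn|j _].
  - case/andP=> le_ij lt_jn; have /forallP/(_ (inord j)) := incr (inord i).
    by rewrite !inordK ?le_ij // (leq_ltn_trans le_ij).
  - by move=> _; apply: step.
  - move=> lt_jk; have /and3P[_ _ /forallP/(_ (inord j))] := strips k lt_kn.
    by rewrite inordK ?lt_jk ?(ltn_trans lt_jk) //= => /eqP; rewrite /height => ->.
  by have /forallP := evens; apply.
split; last first.
  by apply/forallP => j; rewrite -[j]inord_val; apply: H4.
rewrite big_andE; apply/forallP => k; rewrite /strip; apply/and3P; split.
- apply/forallP => i; apply/forallP => j; apply/implyP => le_ij.
  by have := H1 k i j; rewrite /height !inord_val le_ij !ltn_ord => /(_ isT isT).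
- by apply/forallP => j; have := H2 k j; rewrite /height inord_val !ltn_ord => /(_ isT isT).
apply/forallP => j; apply/implyP => lt_jk; apply/eqP/val_inj.
by have := H3 k j; rewrite /height inord_val ltn_ord lt_jk => /(_ isT isT).
Qed.

Lemma height_mono p k l j : admissible p -> k <= l -> j < n -> height p k j <= height p l j.
Proof.
case/admissibleP=> _ step _ _ /subnKC <- lt_jn; elim: (l - k) => [|d IHd]; first by rewrite addn0.
rewrite addnS; apply: leq_trans IHd _; case: (ltnP (k + d) n) => [lt_kn|ge_kn].
  by have /andP[] := step _ j lt_kn lt_jn.
by rewrite !height_top // leqW.
Qed.

Lemma height_le p k j : admissible p -> j < n -> height p k j <= j.
Proof.
move=> adm lt_jn; have [le_kn|/ltnW le_nk] := leqP k n.
  by rewrite -[leqRHS](@height_top p n) //; apply: height_mono.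
by rewrite height_top.
Qed.

(** The letters from t_(j+1) on leave the column of height j alone. *)
Lemma height_flag p k j : admissible p -> j < k -> j < n -> height p k j = j.
Proof.
move=> adm lt_jk lt_jn; have /admissibleP[_ _ fixed _] := adm.
have [le_kn|/ltnW le_nk] := leqP k n; last by rewrite height_top.
have fixed_up d : k + d <= n -> height p k j = height p (k + d) j.
  elim: d => [|d IHd] le_d; first by rewrite addn0.
  rewrite IHd; last by lia.
  by rewrite addnS; apply: fixed; lia.
by rewrite (fixed_up (n - k)) subnKC // height_top.
Qed.

Lemma height_row p k i j : admissible p -> i <= j < n -> height p k i <= height p k j.
Proof.
move=> adm /andP[le_ij lt_jn]; have /admissibleP[incr _ _ _] := adm.
have [lt_kn|ge_kn] := ltnP k n; first by rewrite incr ?le_ij.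
by rewrite !height_top // (leq_ltn_trans le_ij).
Qed.

Lemma height_step p k l j : admissible p -> j < n -> k <= l ->
  height p l j <= height p k j + (l - k).
Proof.
move=> adm lt_jn /subnKC <-; have /admissibleP[_ step _ _] := adm.
rewrite addKn; elim: (l - k) => [|d IHd]; first by rewrite !addn0.
rewrite !addnS; have [lt_kn|ge_kn] := ltnP (k + d) n.
  by have := step _ j lt_kn lt_jn; lia.
rewrite height_top ?(leqW ge_kn) //; apply: leq_trans (leqnSn _).
by rewrite -[leqLHS](@height_top p (k + d) j).
Qed.

Lemma array_eq p q : (forall k j, k < n -> j < n -> height p k j = height q k j) -> p = q.
Proof.
move=> pq; apply/ffunP => k; apply/ffunP => j; apply: val_inj.
by have := pq k j (ltn_ord k) (ltn_ord j); rewrite /height inord_val !levelE.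
Qed.

(** The number of levels at which the box (r, c), in the column of height m.+1 - c,
    is absent: k + 1 if it is removed with the letter t_k, and 0 if it belongs to
    the inner shape. *)
Definition entry p r c := \sum_(k < n.+1) (height p k (m.+1 - c) <= r).

Lemma entry_leE p r c k : admissible p -> k <= n ->
  (entry p r c <= k) = (r < height p k (m.+1 - c)).
Proof.
move=> adm le_kn; apply: (@count_le_threshold n.+1 (fun k => height p k (m.+1 - c))) => //.
by move=> a b /andP[le_ab _]; apply: height_mono => //; lia.
Qed.

Definition inner_of p : {ffun 'I_m.+1 -> 'I_n} :=
  [ffun r : 'I_m.+1 => inord (\sum_(c < m.+1) (r < height p 0 (m.+1 - c)))].

Lemma inner_ofE p r : inner_of p r = \sum_(c < m.+1) (r < height p 0 (m.+1 - c)) :> nat.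
Proof.
rewrite ffunE inordK // ltnS -[leqRHS]card_ord -sum1_card.
by apply: leq_sum => c _; case: (_ < _).
Qed.

Lemma inner_of_gt p (r : 'I_m.+1) c : admissible p -> c < m.+1 ->
  (c < inner_of p r) = (r < height p 0 (m.+1 - c)).
Proof.
move=> adm lt_c; rewrite inner_ofE ltnNge.
pose f c := n - height p 0 (m.+1 - c).
have mono a b : a <= b < m.+1 -> f a <= f b.
  move=> /andP[le_ab lt_b]; apply: leq_sub2l; apply: height_row => //.
  by lia.
have -> : \sum_(c < m.+1) (r < height p 0 (m.+1 - c)) = \sum_(c < m.+1) (f c <= n - r.+1).
  apply: eq_bigr => a _; congr nat_of_bool; rewrite /f.
  by have := height_lt p 0 (m.+1 - a); have := ltn_ord r; lia.
rewrite (count_le_threshold _ mono) // /f.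
by have := height_lt p 0 (m.+1 - c); have := ltn_ord r; lia.
Qed.

Lemma inner_of_inner p : admissible p -> @inner_shape n (inner_of p).
Proof.
move=> adm; apply/andP; split; last first.
  apply/forallP => r0; pose r : 'I_m.+1 := r0; rewrite -[r0]/r.
  have [//|lt] := leqP (inner_of p r) (rho n r).
  have lt_r : r < m.+1 := ltn_ord r.
  have lt_rho : rho n r < m.+1 by apply: leq_trans lt _; rewrite -ltnS.
  have rhoK : m.+1 - rho n r = r by rewrite /rho; lia.
  have lt_rn : r < n by apply: ltn_trans lt_r _.
  by have := @height_le p 0 r adm lt_rn; rewrite inner_of_gt // rhoK in lt; lia.
apply/forallP => r; apply/forallP => r'; apply/implyP => le_r.
rewrite !inner_ofE; apply: leq_sum => c _; have [lt|//] := ltnP.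
by rewrite (leq_ltn_trans le_r lt).
Qed.

Lemma inner_of_even p : admissible p -> @even_columns n (inner_of p).
Proof.
move=> adm; apply/forallP => c; rewrite -sum1dep_card big_mkcond /=.
under eq_bigr => r _ do rewrite inner_of_gt //.
have -> : \sum_(r < m.+1) (if r < height p 0 (m.+1 - c) then 1 else 0) =
          height p 0 (m.+1 - c).
  rewrite -[RHS](@sum_ltn m.+1); last by rewrite -ltnS height_lt.
  by apply: eq_bigr => r _; case: ltnP.
by have /admissibleP[_ _ _ ->] := adm; last by lia.
Qed.

End HeightArrays.

(** * Tableaux *)

Section Tableaux.
Context (m : nat).
Local Notation n := m.+2.
Local Notation array := {ffun 'I_n -> heights m.+1}.
Context (mu : {ffun 'I_m.+1 -> 'I_n}).
Local Notation box := (@skew_box n mu).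
Local Notation filling := (@filling n mu).
Implicit Types (b : box) (T : filling) (p : array) (r c : nat).

Definition row_of b : nat := (box_row b : 'I_m.+1).
Definition col_of b : nat := (box_col b : 'I_m.+1).
Definition mu_row r : nat := mu (inord r).

Lemma box_bounds b : mu_row (row_of b) <= col_of b /\ row_of b + col_of b < m.+1.
Proof.
case: b => -[r c] bP; have /andP[le_mu lt_rho] := bP.
rewrite /mu_row /row_of /col_of /box_row /box_col /= (inord_val (r : 'I_m.+1)); split=> //.
have := lt_rho; rewrite /rho /=.
by have : (r : 'I_m.+1) < m.+1 := ltn_ord r; lia.
Qed.

Lemma box_exists r c : mu_row r <= c -> r + c < m.+1 -> exists b, row_of b = r /\ col_of b = c.
Proof.
move=> le_mu lt_rc.
have lt_r : r < m.+1 by lia.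
have lt_c : c < m.+1 by lia.
pose rr : 'I_m.+1 := Ordinal lt_r; pose cc : 'I_m.+1 := Ordinal lt_c.
have in_box : mu rr <= cc < rho n rr.
  apply/andP; split; last by rewrite /rho /=; lia.
  by move: le_mu; rewrite /mu_row (_ : inord r = rr) //; apply: val_inj; rewrite /= inordK.
by exists (exist (fun b : 'I_n.-1 * 'I_n.-1 => mu b.1 <= b.2 < rho n b.1) (rr, cc) in_box).
Qed.

(** The filling extended by 0 to the boxes of the inner shape. *)
Definition letter T r c : nat := \sum_(b | (row_of b == r) && (col_of b == c)) T b.

Lemma letter_box T b : letter T (row_of b) (col_of b) = T b.
Proof.
by rewrite /letter (big_pred1 b).
Qed.

Lemma letter_le T r c : letter T r c <= n.
Proof.
rewrite /letter; have [b|no_box] := pickP (fun b => (row_of b == r) && (col_of b == c)).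
  case/andP=> /eqP <- /eqP <-; rewrite -/(letter T (row_of b) (col_of b)) letter_box.
  by rewrite -ltnS ltn_ord.
by rewrite big_pred0.
Qed.

Lemma letter_inner T r c : c < mu_row r -> letter T r c = 0.
Proof.
move=> lt_mu; rewrite /letter big_pred0 // => b.
have [le_mu _] := box_bounds b.
by apply/negP => /andP[/eqP rE /eqP cE]; move: le_mu; rewrite rE cE leqNgt lt_mu.
Qed.

Hypothesis mu_inner : @inner_shape n mu.

Lemma mu_row_decr r r' : r <= r' < m.+1 -> mu_row r' <= mu_row r.
Proof.
case/andP: mu_inner => /forallP decr _ /andP[le_r lt_r'].
have /forallP/(_ (inord r' : 'I_m.+1))/implyP := decr (inord r : 'I_m.+1).
by apply; rewrite !inordK ?(leq_ltn_trans le_r).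
Qed.

Lemma mu_row_le r : r < m.+1 -> mu_row r <= m.+1 - r.
Proof.
move=> lt_r; case/andP: mu_inner => _ /forallP/(_ (inord r : 'I_m.+1)).
by rewrite /rho inordK //.
Qed.

(** Semistandardness and the flag condition for fillings of the whole staircase; an
    entry 0 marks a box of the inner shape, and may repeat in a column. *)
Definition tableau_like (u : nat -> nat -> nat) :=
  [/\ forall r c, mu_row r <= c -> r + c < m.+1 -> 0 < u r c,
      forall r c c', c <= c' -> r + c' < m.+1 -> u r c <= u r c',
      forall r r' c, r < r' -> r' + c < m.+1 -> u r c = 0 \/ u r c < u r' c
    & forall r c, r + c < m.+1 -> u r c <= r.+2].

Lemma tableau_letters T :
  reflect (tableau_like (letter T)) (semistandard T && flagged T).
Proof.
apply: (iffP andP) => [[/and3P[/forallP pos /forallP rows /forallP cols] /forallP flag]|[H1 H2 H3 H4]].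
  have rowsP b b' : row_of b = row_of b' -> col_of b <= col_of b' -> T b <= T b'.
    move=> rr cc; have /forallP/(_ b')/implyP := rows b; apply.
    by rewrite cc andbT; apply/eqP/val_inj.
  have colsP b b' : col_of b = col_of b' -> row_of b < row_of b' -> T b < T b'.
    move=> cc rr; have /forallP/(_ b')/implyP := cols b; apply.
    by rewrite rr andbT; apply/eqP/val_inj.
  split=> [r c le_mu lt_rc|r c c' le_cc lt_rc|r r' c lt_rr lt_rc|r c lt_rc].
  - by have [b [<- <-]] := box_exists le_mu lt_rc; rewrite letter_box.
  - have [lt_mu|le_mu] := ltnP c (mu_row r); first by rewrite letter_inner.
    have [b [rb cb]] : exists b, row_of b = r /\ col_of b = c by apply: box_exists; lia.
    have [b' [rb' cb']] : exists b, row_of b = r /\ col_of b = c' by apply: box_exists; lia.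
    rewrite -[in leqLHS]rb -[in leqLHS]cb letter_box -rb' -cb' letter_box.
    by apply: rowsP; rewrite ?rb ?rb' ?cb ?cb'.
  - have [lt_mu|le_mu] := ltnP c (mu_row r); first by left; rewrite letter_inner.
    right; have le_mu' : mu_row r' <= mu_row r by apply: mu_row_decr; lia.
    have [b [rb cb]] : exists b, row_of b = r /\ col_of b = c by apply: box_exists; lia.
    have [b' [rb' cb']] : exists b, row_of b = r' /\ col_of b = c by apply: box_exists; lia.
    have := @colsP b b'; rewrite rb rb' cb cb' => /(_ (erefl _) lt_rr).
    by rewrite -!letter_box rb rb' cb cb'.
  have [lt_mu|le_mu] := ltnP c (mu_row r); first by rewrite letter_inner.
  have [b [<- <-]] := box_exists le_mu lt_rc; rewrite letter_box; exact: flag.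
split; last first.
  apply/forallP => b; have [_ lt_rc] := box_bounds b.
  by rewrite -letter_box; apply: H4.
apply/and3P; split; apply/forallP => b; have [le_mu lt_rc] := box_bounds b.
- by rewrite -letter_box; apply: H1.
- apply/forallP => b'; apply/implyP => /andP[/eqP rr cc].
  have [le_mu' lt_rc'] := box_bounds b'.
  have rE : row_of b = row_of b' by rewrite /row_of rr.
  by rewrite -!letter_box rE; apply: H2.
apply/forallP => b'; apply/implyP => /andP[/eqP cc rr].
have [le_mu' lt_rc'] := box_bounds b'.
have cE : col_of b = col_of b' by rewrite /col_of cc.
have := H3 _ _ _ rr lt_rc'; rewrite -[in letter T (box_row b)]/(row_of b) -cE !letter_box.
rewrite cE letter_box.
by have := H1 _ _ le_mu lt_rc; rewrite letter_box => pos [z|//]; rewrite z in pos.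
Qed.

End Tableaux.

(** * Arrays and tableaux *)

Section Bijection.
Context (m : nat).
Local Notation n := m.+2.
Local Notation array := {ffun 'I_n -> heights m.+1}.
Context (mu : {ffun 'I_m.+1 -> 'I_n}).
Local Notation box := (@skew_box n mu).
Local Notation filling := (@filling n mu).
Implicit Types (b : box) (T : filling) (p : array) (r c : nat).
Hypothesis mu_inner : @inner_shape n mu.
Hypothesis mu_even : @even_columns n mu.

Lemma box_lt b : (row_of b < m.+1) * (col_of b < m.+1) * (row_of b + col_of b < m.+1).
Proof. by have [_ lt] := box_bounds b; split=> //; split; lia. Qed.

Definition tableau_of p : filling := [ffun b => inord (entry p (row_of b) (col_of b))].

(** The height at level k of a column counts its boxes whose entry is at most k. *)
Definition array_of T : array :=
  [ffun k : 'I_n => [ffun j : 'I_n => inord (\sum_(r < j) (letter T r (m.+1 - j) <= k))]].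

Lemma entry_le p r c : admissible p -> r + c < m.+1 -> entry p r c <= n.
Proof. by move=> adm lt_rc; rewrite entry_leE // height_top; lia. Qed.

Lemma mu_row_gt p r c : admissible p -> inner_of p = mu -> r + c < m.+1 ->
  (c < mu_row mu r) = (r < height p 0 (m.+1 - c)).
Proof.
move=> adm <- lt_rc; rewrite /mu_row inner_of_gt ?inordK //; lia.
Qed.

Lemma letter_tableau_of p r c : admissible p -> inner_of p = mu -> r + c < m.+1 ->
  letter (tableau_of p) r c = entry p r c.
Proof.
move=> adm shp lt_rc.
have [lt_mu|le_mu] := ltnP c (mu_row mu r).
  rewrite letter_inner //; apply/esym/eqP; rewrite -leqn0 entry_leE //.
  by rewrite -mu_row_gt.
have [b [<- <-]] := box_exists le_mu lt_rc; rewrite letter_box ffunE inordK //.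
by rewrite ltnS entry_le // box_lt.
Qed.

(** Heights grow by at most one per level.  Hence, if the box in row r has the entry
    e + 1, so that the height at level e is at most r, the box above it is still
    absent at level e + 1.  For the flag condition, a column of height j is
    complete at level j + 1, so it has at least r + 1 boxes at level r + 2. *)
Lemma tableau_of_tableau p : admissible p -> inner_of p = mu ->
  tableau_like mu (letter (tableau_of p)).
Proof.
move=> adm shp; split=> [r c le_mu lt_rc|r c c' le_cc lt_rc|r r' c lt_rr lt_rc|r c lt_rc].
- by rewrite letter_tableau_of // ltnNge entry_leE // -mu_row_gt // -leqNgt.
- rewrite !letter_tableau_of //; last by lia.
  apply: leq_sum => k _; have [le|//] := leqP (height p k (m.+1 - c)) r.
  by rewrite (leq_trans _ le) // height_row //; lia.
- rewrite !letter_tableau_of //; last by lia.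
  case E : (entry p r c) => [|e]; [by left|right].
  have le_en : e.+1 <= n by rewrite -E entry_le //; lia.
  rewrite ltnNge entry_leE // -leqNgt.
  have : ~~ (entry p r c <= e) by rewrite E ltnn.
  rewrite entry_leE //; last by lia.
  by have := @height_step _ p e e.+1 (m.+1 - c) adm; lia.
rewrite letter_tableau_of //.
have [lt_n|le_n] := ltnP r.+2 n; last by apply: leq_trans le_n; apply: entry_le.
rewrite entry_leE //; last by lia.
have [lt|ge] := ltnP r.+2 (m.+2 - c); last first.
  by rewrite (height_flag adm); lia.
have := @height_step _ p r.+2 (m.+2 - c) (m.+1 - c) adm.
by rewrite (@height_flag _ p (m.+2 - c)) //; lia.
Qed.

Lemma height_array_of T k j : j < n ->
  height (array_of T) k j = \sum_(r < j) (letter T r (m.+1 - j) <= k).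
Proof.
move=> lt_jn.
have le_j : \sum_(r < j) (letter T r (m.+1 - j) <= k) <= j.
  by rewrite -[leqRHS]card_ord -sum1_card; apply: leq_sum => r _; apply: leq_b1.
have [lt_kn|ge_kn] := ltnP k n.
  rewrite /height -[k]/(nat_of_ord (Ordinal lt_kn)) levelE !ffunE !inordK //.
  exact: leq_ltn_trans le_j _.
rewrite height_top // -[LHS]card_ord -sum1_card; apply: eq_bigr => r _.
by rewrite (leq_trans (letter_le _ _ _)).
Qed.

Lemma tableau_ofK p : admissible p -> inner_of p = mu -> array_of (tableau_of p) = p.
Proof.
move=> adm shp; apply: array_eq => k j lt_kn lt_jn; rewrite height_array_of //.
rewrite -[RHS](@sum_ltn j); last exact: height_le.
apply: eq_bigr => r _; have lt_rj := ltn_ord r.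
by rewrite letter_tableau_of ?entry_leE ?subKn //; lia.
Qed.

Section FromTableau.
Context (T : filling).
Hypothesis tabT : tableau_like mu (letter T).

Lemma letter_col j r r' : j < n -> r <= r' < j ->
  letter T r (m.+1 - j) <= letter T r' (m.+1 - j).
Proof.
move=> lt_jn; case/andP; rewrite leq_eqVlt => /orP[/eqP-> //|lt_rr] lt_rj.
have [_ _ cols _] := tabT.
by case: (cols r r' (m.+1 - j) lt_rr) => [|->|/ltnW//]; lia.
Qed.

Lemma height_array_of_step k j : j < n ->
  height (array_of T) k.+1 j =
  height (array_of T) k j + \sum_(r < j) (letter T r (m.+1 - j) == k.+1).
Proof.
move=> lt_jn; rewrite !height_array_of // -big_split; apply: eq_bigr => r _ /=.
by rewrite (leq_eqVlt _ k.+1) ltnS; case: eqP => [->|]; rewrite ?addn0 // ltnn.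
Qed.

(** Rows increase weakly, so the longer columns, which lie on the left, contain at
    least as many entries up to a given letter; columns increase strictly, so each letter occurs
    at most once in a column; and the flag condition bounds the entries of the
    column of height j by j + 1. *)
Lemma array_of_admissible : admissible (array_of T).
Proof.
have [pos rows cols flag] := tabT.
apply/admissibleP; split=> [k i j lt_kn /andP[le_ij lt_jn]|k j lt_kn lt_jn|k j lt_kn lt_jk|j lt_jn].
- rewrite !height_array_of //; last by lia.
  rewrite (big_ord_widen j (fun r => (letter T r (m.+1 - i) <= k) : nat) le_ij) big_mkcond /=.
  apply: leq_sum => r _; case: ifP => // lt_ri.
  have [le|//] := leqP (letter T r (m.+1 - i)) k.
  by rewrite (leq_trans _ le) // rows; lia.
- rewrite height_array_of_step // leq_addr /= -[leqRHS]addn1 leq_add2l.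
  have [/existsP[r /eqP rE]|/existsPn none] :=
      boolP [exists r : 'I_j, letter T r (m.+1 - j) == k.+1]; last first.
    by rewrite big1 // => r _; rewrite (negPf (none r)).
  rewrite (bigD1 r) //= rE eqxx big1 // => r' neq.
  have lt_rj := ltn_ord r; have lt_rj' := ltn_ord r'.
  have [lt|lt|/val_inj eq] := ltngtP r r'; last by rewrite eq eqxx in neq.
    by have := cols r r' (m.+1 - j) lt; rewrite rE; lia.
  by have := cols r' r (m.+1 - j) lt; rewrite rE; lia.
- have lt_jn : j < n by apply: ltn_trans lt_jk _.
  rewrite height_array_of_step // big1 ?addn0 // => r _; have lt_rj := ltn_ord r.
  by have := flag r (m.+1 - j); lia.
rewrite height_array_of //; case: j lt_jn => [|j] lt_jn; first by rewrite big_ord0.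
have lt_c : m.+1 - j.+1 < m.+1 by lia.
have /forallP/(_ (Ordinal lt_c : 'I_m.+1)) := mu_even.
congr (~~ odd _); rewrite -sum1dep_card /=.
rewrite (big_ord_widen m.+1 (fun r => (letter T r (m.+1 - j.+1) <= 0) : nat)); last by lia.
rewrite big_mkcond [RHS]big_mkcond /=; apply: eq_bigr => r _.
have muE : mu_row mu r = mu r by rewrite /mu_row inord_val.
rewrite -muE; have lt_r : r < m.+1 := ltn_ord r.
have := mu_row_le mu_inner lt_r; have := pos r (m.+1 - j.+1).
have := @letter_inner _ _ T r (m.+1 - j.+1).
by do 3?case: ifPn => //; lia.
Qed.

Lemma entry_array_of r c : r + c < m.+1 -> entry (array_of T) r c = letter T r c.
Proof.
move=> lt_rc; rewrite -[RHS](@sum_ltn n.+1); last by rewrite ltnW // ltnS letter_le.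
have lt_j : m.+1 - c < n by lia.
apply: eq_bigr => k _; congr nat_of_bool; rewrite height_array_of //.
have cE : m.+1 - (m.+1 - c) = c by lia.
rewrite (@count_le_threshold _ (fun r => letter T r (m.+1 - (m.+1 - c)))) ?cE //; last by lia.
by move=> a b le_ab; have := letter_col lt_j le_ab; rewrite cE.
Qed.

Lemma array_ofK : tableau_of (array_of T) = T.
Proof.
apply/ffunP => b; apply: val_inj; rewrite ffunE /= entry_array_of ?box_lt //.
by rewrite letter_box inordK.
Qed.

Lemma inner_of_array_of : inner_of (array_of T) = mu.
Proof.
have adm := array_of_admissible.
have gtE (r : 'I_m.+1) c : c < m.+1 -> (c < inner_of (array_of T) r) = (c < mu r).
  move=> lt_c; rewrite inner_of_gt //.
  have muE : mu_row mu r = mu r by rewrite /mu_row inord_val.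
  have lt_r : r < m.+1 := ltn_ord r.
  have le_mu := mu_row_le mu_inner lt_r; rewrite -muE.
  have [lt_rc|ge_rc] := ltnP (r + c) m.+1; last first.
    have := @height_le _ _ 0 (m.+1 - c) adm; lia.
  rewrite -(@entry_leE _ _ _ _ 0) // entry_array_of // leqn0.
  have [pos _ _ _] := tabT; have := pos r c; have := @letter_inner _ _ T r c.
  by case: (ltnP c (mu_row mu r)); case: eqP; lia.
apply/ffunP => r; apply: val_inj => /=; apply/eqP; rewrite eqn_leq.
have lt1 := ltn_ord (inner_of (array_of T) r); have lt2 := ltn_ord (mu r).
have := gtE r (mu r); have := gtE r (inner_of (array_of T) r).
by rewrite !ltnn; lia.
Qed.

Lemma strip_size_array_of k :
  strip_size (level (array_of T) (full_heights m.+1) k.+1)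
             (level (array_of T) (full_heights m.+1) k)
  = \sum_b (T b == k.+1 :> nat).
Proof.
transitivity (\sum_(j < n) \sum_(r < j) (letter T r (m.+1 - j) == k.+1)).
  apply: eq_bigr => j _; have := @height_array_of_step k j (ltn_ord j).
  by rewrite /height inord_val => ->; rewrite addKn.
rewrite [RHS](partition_big (fun b => inord (m.+1 - col_of b) : 'I_n) xpredT) //=.
apply: eq_bigr => j _; have lt_j := ltn_ord j.
rewrite [RHS](partition_big (fun b => inord (row_of b) : 'I_n) xpredT) //=.
rewrite (big_ord_widen n (fun r => (letter T r (m.+1 - j) == k.+1) : nat)) ?(ltnW lt_j) //.
rewrite big_mkcond; apply: eq_bigr => r _; have lt_r := ltn_ord r.
have condE b : ((inord (m.+1 - col_of b) : 'I_n) == j) && ((inord (row_of b) : 'I_n) == r) =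
    (row_of b == r) && (col_of b == m.+1 - j).
  have [[lt_rb lt_cb] lt_rcb] := box_lt b; rewrite -!val_eqE /= !inordK;
    [apply/idP/idP; lia|lia|lia].
rewrite (eq_bigl _ _ condE); case: ltnP => [lt_rj|le_jr]; last first.
  rewrite big_pred0 // => b; have [[lt_rb lt_cb] lt_rcb] := box_lt b; lia.
have [b|no_box] := pickP (fun b => (row_of b == r) && (col_of b == m.+1 - j)).
  case/andP=> /eqP rE /eqP cE; rewrite -rE -cE letter_box (big_pred1 b) //.
by rewrite big_pred0 // /letter big_pred0.
Qed.

End FromTableau.

Lemma tableau_weight (R : comNzRingType) (t : nat -> R) T :
  tableau_like mu (letter T) ->
  (\prod_(k < n) t k ^+ strip_size (level (array_of T) (full_heights m.+1) k.+1)
                                  (level (array_of T) (full_heights m.+1) k)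
   = \prod_b t (T b).-1)%R.
Proof.
move=> tabT.
transitivity (\prod_(k < n) \prod_b t k ^+ (T b == k.+1 :> nat))%R.
  by apply: eq_bigr => k _; rewrite -expr_sum (strip_size_array_of T k).
rewrite exchange_big; apply: eq_bigr => b _ /=.
have [le_mu lt_rc] := box_bounds b; have [pos _ _ _] := tabT.
have {pos} := pos _ _ le_mu lt_rc; rewrite letter_box => pos.
have lt_Tn : (T b).-1 < n by have := ltn_ord (T b); lia.
rewrite (bigD1 (Ordinal lt_Tn)) //= prednK // eqxx expr1 big1 ?mulr1 // => k neq.
by rewrite (_ : (_ == _) = false) ?expr0 //; apply: contraNF neq => /eqP TE; rewrite -val_eqE /= TE.
Qed.

Lemma array_tableau_sum (R : comNzRingType) (t : nat -> R) :
  (\sum_(p | admissible p && (inner_of p == mu))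
     \prod_(k < n) t k ^+ strip_size (level p (full_heights m.+1) k.+1)
                                    (level p (full_heights m.+1) k)
   = \sum_(T : filling | semistandard T && flagged T) \prod_b t (T b).-1)%R.
Proof.
rewrite (reindex_onto array_of tableau_of); last first.
  by move=> p /andP[adm /eqP shp]; rewrite tableau_ofK.
apply: eq_big => [T|T].
  apply/andP/tableau_letters => // [[/andP[adm /eqP shp] /eqP <-]|tabT].
    exact: tableau_of_tableau.
  by rewrite array_of_admissible // inner_of_array_of // array_ofK // !eqxx.
case/andP=> /andP[adm /eqP shp] /eqP TE; rewrite tableau_weight //.
by rewrite -TE; apply: tableau_of_tableau.
Qed.

End Bijection.

Local Close Scope nat_scope.

Theorem theorem6 (n : nat) (n_ge2 : (2 <= n)%N) :
  Nct n =
    \sum_(mu : {ffun 'I_n.-1 -> 'I_n} | inner_shape mu && even_columns mu)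
      \sum_(T : filling mu | semistandard T && flagged T)
        \prod_(b : skew_box mu) tvar n (T b).-1.
Proof.
case: n n_ge2 => [|[|m]] // _.
rewrite Nct_letter_series letter_series_arrays; last exact: mpoly_no_2torsion.
rewrite (partition_big (@inner_of m)
  (fun mu : {ffun 'I_m.+1 -> 'I_m.+2} => @inner_shape m.+2 mu && @even_columns m.+2 mu)) /=.
  by apply: eq_bigr => mu /andP[mu_inner mu_even]; apply: array_tableau_sum.
by move=> p adm; rewrite inner_of_inner // inner_of_even.
Qed.
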